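(* Let $G$, $f$, $G'$ satisfy the standing assumptions listed in the context. Let $\epsilon\in(0,\infty)$ and let $\Lambda\subset G$ be a bounded connected component of $E_{f,\epsilon}$. Let $\delta>0$ be given. Then there is some $\eta\in(0,\epsilon)$ such that for each $\zeta\in(\epsilon-\eta,\epsilon+\eta)$ there is some finite collection $L_1,\ldots,L_N$ of level curves of $f$ contained in $G$ such that $|f|\equiv\zeta$ on each $L_i$, and $\check{d}\left(\bigcup_{i=1}^N L_i,\Lambda\right)<\delta$.
   Context: Standing assumptions: $G\subset\mathbb{C}$ is open and $f$ is meromorphic on an open set $G'\supset\mathrm{cl}(G)$. For $\epsilon\in[0,\infty]$ let $E_{f,\epsilon}=\{z\in G':|f(z)|=\epsilon\}$ (a level set of $f$); a level curve of $f$ is a connected component of some $E_{f,\epsilon}$, and for $z\in G$, $\Lambda_z$ denotes the component of $E_{f,|f(z)|}$ containing $z$. Moreover: (1) $|f|\equiv1$ on any unbounded component of $\partial G$, and for each bounded component $K$ of $\partial G$ there is some $\rho\in(0,\infty)$ with $|f|\equiv\rho$ on $K$. If a component of $G^c$ is a single point $\{z\}$, then $G$ is replaced by $G\cup\{z\}$, so no component of $G^c$ is a single point. (2) If $G$ is unbounded, then $\lim_{z\in G,\,z\to\infty}|f(z)|=1$. (3) $G$ does not contain any unbounded level curve of $f$. (4) $G$ is connected and $G^c=\mathbb{C}\setminus G$ has finitely many bounded components. (5) No level curve of $f$ in $G$ intersects $\partial G$; that is, for any $z\in G$, $\mathrm{cl}(\Lambda_z)\subset G$. Distance: for $X,Y\subset\mathbb{C}$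 non-empty, $d(X,Y)$ is the usual distance $\inf\{|x-y|:x\in X,y\in Y\}$, $d_1(X,Y)=\sup_{x\in X}d(\{x\},Y)$, $d_2(X,Y)=\sup_{y\in Y}d(X,\{y\})$, and $\check d(X,Y)=\max(d_1(X,Y),d_2(X,Y))$; if $X$ or $Y$ is empty, $\check d(X,Y)=\infty$. *)

(* Defs.v *)
From HB Require Import structures.
From mathcomp Require Import all_boot all_order all_algebra.
From mathcomp Require Import all_classical all_reals all_analysis.
From mathcomp Require Import complex.
Set Implicit Arguments.
Unset Strict Implicit.
Unset Printing Implicit Defensive.
Import Order.TTheory GRing.Theory Num.Theory.
Import numFieldNormedType.Exports.
Local Open Scope classical_set_scope.
Local Open Scope ring_scope.

(* R[i] carries no topology in the libraries; it is given the one induced by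
   its norm, so that [derivable _ _ 1] on R[i] is complex differentiability. *)
HB.instance Definition _ (R : realType) := NormedModule.copy R[i] (R[i])^o.

(* The real-valued modulus: the norm `|z| of the library lives in R[i]. *)
Definition cmod (R : realType) (z : R[i]) : R := complex.Re `|z|.

(* Neighbourhoods of the point at infinity of the plane. *)
Definition cinfty_nbhs (R : realType) : set_system R[i] :=
  filter_from setT (fun M : R => [set z | M < cmod z]).

(* [K] is a connected component of the subspace [A]. *)
Definition is_component (T : topologicalType) (A K : set T) : Prop :=
  exists2 x, A x & K = connected_component A x.

Definition boundary (T : topologicalType) (A : set T) : set T :=
  closure A `\` interior A.

(* Functions to the Riemann sphere are maps to [option R[i]], with [None] for
   the point at infinity. *)
Definition absf (R : realType) (f : R[i] -> option R[i]) (z : R[i]) : \bar R :=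
  if f z is Some w then (cmod w)%:E else +oo%E.

Definition finite_part (R : realType) (f : R[i] -> option R[i]) (z : R[i]) :
  R[i] := odflt 0 (f z).

Definition holomorphic_point (R : realType) (f : R[i] -> option R[i])
  (z : R[i]) : Prop := f z <> None /\ derivable (finite_part f) z 1.

Definition pole (R : realType) (f : R[i] -> option R[i]) (p : R[i]) : Prop :=
  [/\ f p = None,
      \forall z \near p^', holomorphic_point f z &
      absf f z @[z --> p^'] --> +oo%E].

Definition meromorphic (R : realType) (U : set R[i])
    (f : R[i] -> option R[i]) : Prop :=
  forall p, U p ->
    (\forall z \near p, holomorphic_point f z) \/ pole f p.

Definition level_set (R : realType) (f : R[i] -> option R[i]) (G' : set R[i])
  (e : \bar R) : set R[i] := [set z | G' z /\ absf f z = e].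

Definition level_curve (R : realType) (f : R[i] -> option R[i])
    (G' L : set R[i]) : Prop :=
  exists2 e : \bar R, (0 <= e)%E & is_component (level_set f G' e) L.

Definition level_curve_at (R : realType) (f : R[i] -> option R[i])
    (G' : set R[i]) (z : R[i]) : set R[i] :=
  connected_component (level_set f G' (absf f z)) z.

Record standing_assumptions (R : realType) (G G' : set R[i])
    (f : R[i] -> option R[i]) : Prop := StandingAssumptions {
  sa_open : open G;
  sa_open' : open G';
  sa_closure_sub : closure G `<=` G';
  sa_meromorphic : meromorphic G' f;
  sa_unbounded_boundary : forall K, is_component (boundary G) K ->
    ~ bounded_set K -> forall z, K z -> absf f z = 1%E;
  sa_bounded_boundary : forall K, is_component (boundary G) K ->
    bounded_set K ->
    exists2 rho : R, 0 < rho & forall z, K z -> absf f z = rho%:E;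
  (* Normalization: a one-point component {z} of the complement is filled in by
     replacing G with its union with {z}. *)
  sa_no_point_component : forall z, ~ is_component (~` G) [set z];
  sa_lim_infty : ~ bounded_set G ->
    absf f z @[z --> within G (@cinfty_nbhs R)] --> 1%E;
  sa_no_unbounded_level_curve : forall L, level_curve f G' L -> L `<=` G ->
    bounded_set L;
  sa_connected : connected G;
  sa_finite_bounded_components :
    finite_set [set K | is_component (~` G) K /\ bounded_set K];
  sa_level_curve_inside : forall z, G z ->
    closure (level_curve_at f G' z) `<=` G
}.

Definition dist_set (R : realType) (X Y : set R[i]) : \bar R :=
  ereal_inf [set (cmod (x - y))%:E | x in X & y in Y].

Definition dist1 (R : realType) (X Y : set R[i]) : \bar R :=
  ereal_sup [set dist_set [set x] Y | x in X].

Definition dist2 (R : realType) (X Y : set R[i]) : \bar R :=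
  ereal_sup [set dist_set X [set y] | y in Y].

Definition dist_check (R : realType) (X Y : set R[i]) : \bar R :=
  if `[< X = set0 \/ Y = set0 >] then +oo%E
  else Order.max (dist1 X Y) (dist2 X Y).

(* Main.v *)
Require Import Defs.
From HB Require Import structures.
From mathcomp Require Import all_boot all_order all_algebra.
From mathcomp Require Import all_classical all_reals all_analysis.
From mathcomp Require Import complex.
From mathcomp Require Import ring lra.
Set Implicit Arguments.
Unset Strict Implicit.
Unset Printing Implicit Defensive.
Import Order.TTheory GRing.Theory Num.Theory.
Import numFieldNormedType.Exports.
Local Open Scope classical_set_scope.
Local Open Scope ring_scope.

(* If |f| had a local extremum at a point of Lambda, f would be constant on G by
   the maximum principle and the identity theorem, and Lambda would contain G,
   which is then bounded and closed as well as open.  Hence |f| takes all values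
   near epsilon close to every point of Lambda, uniformly by compactness.
   Lambda is a component of a compact piece of the level set, so it has
   arbitrarily small neighbourhoods U whose boundary misses the level set; for
   zeta near epsilon the boundary also misses the level set of zeta, so that the
   level curves of zeta meeting U are trapped in U.

   No integral is used: a Riemann-sum version of Goursat's lemma, applied to
   (f - f x)^2 / (z - x), gives |f x| <= 5 max |f| on a square centred at x, and
   the factor 5 disappears by applying this to the powers of f. *)

(** * The modulus *)

Section Modulus.
Variable R : realType.
Implicit Types (z w p : R[i]) (d e : R).

(** The components of the level set of [zeta] are never counted: finiteness of the collection comes
    from a finite net in the compact set [Lambda], with one level curve chosen for each net point.
    Trapping these curves near [Lambda] gives one half of the distance estimate, the density of the
    net the other. As [epsilon] is positive and finite, [Lambda] carries no zeros or poles, so the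
    minimum principle is available there through [1 / f]. On the analytic side the obstacle is that
    differentiability of [f] at [x] makes [(f z - f x) / (z - x)] continuous at [x] but not
    obviously differentiable; removing that singularity would need the Cauchy theory that is being
    avoided. Squaring the numerator leaves [phi z ^+ 2 * (z - x)] with [phi] continuous, which is
    differentiable at [x], at the price of a quadratic inequality for |f x| and a worse constant.
    The same squaring handles division by zeros of [h] in the identity theorem, so that no power
    series and no order of a zero appear. *)

Lemma normCE z : `|z| = (cmod z)%:C%C.
Proof. by rewrite /cmod normc_def. Qed.

Lemma cmodE z : cmod z = Num.sqrt (complex.Re z ^+ 2 + complex.Im z ^+ 2).
Proof. by rewrite /cmod normc_def. Qed.

Lemma cmod_sqr z : cmod z ^+ 2 = complex.Re z ^+ 2 + complex.Im z ^+ 2.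
Proof. by rewrite cmodE sqr_sqrtr// addr_ge0// sqr_ge0. Qed.

Lemma cmod_ge0 z : 0 <= cmod z.
Proof. by rewrite cmodE sqrtr_ge0. Qed.

Lemma cmodM z w : cmod (z * w) = cmod z * cmod w.
Proof. by apply: complexI; rewrite rmorphM -!normCE normrM. Qed.

Lemma cmodV z : cmod z^-1 = (cmod z)^-1.
Proof. by apply: complexI; rewrite fmorphV -!normCE normfV. Qed.

Lemma cmodN z : cmod (- z) = cmod z.
Proof. by rewrite /cmod normrN. Qed.

Lemma cmodB z w : cmod (z - w) = cmod (w - z).
Proof. by rewrite -cmodN opprB. Qed.

Lemma cmodD z w : cmod (z + w) <= cmod z + cmod w.
Proof. by rewrite -lecR rmorphD -!normCE ler_normD. Qed.

Lemma cmodX z n : cmod (z ^+ n) = cmod z ^+ n.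
Proof. by apply: complexI; rewrite rmorphXn -!normCE normrX. Qed.

Lemma cmod0 : cmod (0 : R[i]) = 0.
Proof. by rewrite /cmod normr0. Qed.

Lemma cmod1 : cmod (1 : R[i]) = 1.
Proof. by rewrite /cmod normr1. Qed.

Lemma cmod_eq0 z : (cmod z == 0) = (z == 0).
Proof. by rewrite -(inj_eq (@complexI R)) -normCE normr_eq0. Qed.

Lemma cmod_gt0 z : (0 < cmod z) = (z != 0).
Proof. by rewrite lt_def cmod_eq0 cmod_ge0 andbT. Qed.

Lemma cmodC (x : R) : cmod x%:C%C = `|x|.
Proof. by rewrite cmodE/= expr0n addr0 sqrtr_sqr. Qed.

Lemma cmod_nat n : cmod (n%:R : R[i]) = n%:R.
Proof. by rewrite -(rmorph_nat (real_complex R)) cmodC ger0_norm. Qed.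

Lemma cmodi : cmod ('i%C : R[i]) = 1.
Proof. by rewrite cmodE/= expr0n add0r expr1n sqrtr1. Qed.

Lemma Re_le_cmod z : `|complex.Re z| <= cmod z.
Proof. by rewrite -lecR -normCE normc_ge_Re. Qed.

Lemma Im_le_cmod z : `|complex.Im z| <= cmod z.
Proof.
by rewrite cmodE -sqrtr_sqr ler_wsqrtr// lerDr sqr_ge0.
Qed.

Lemma cmod_le_ReIm z : cmod z <= `|complex.Re z| + `|complex.Im z|.
Proof.
rewrite cmodE -[leRHS]ger0_norm ?addr_ge0// -sqrtr_sqr ler_wsqrtr//.
rewrite sqrrD -(real_normK (num_real (complex.Re z))).
rewrite -(real_normK (num_real (complex.Im z))) lerD2r lerDl.
by rewrite mulrn_wge0 // mulr_ge0.
Qed.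

Lemma cmod_triangle z w p : cmod (z - p) <= cmod (z - w) + cmod (w - p).
Proof. by apply: le_trans (cmodD _ _); rewrite subrKA. Qed.

Lemma cmod_sub z w : `|cmod z - cmod w| <= cmod (z - w).
Proof.
have := cmodD (z - w) w; have := cmodD (w - z) z.
rewrite !subrK (cmodB w z) => h1 h2; rewrite ler_norml.
by apply/andP; split; lra.
Qed.

Lemma cmod_sum (I : Type) (r : seq I) (P : pred I) (F : I -> R[i]) :
  cmod (\sum_(i <- r | P i) F i) <= \sum_(i <- r | P i) cmod (F i).
Proof.
elim/big_ind2: _ => [|x1 x2 y1 y2 h1 h2|//]; first by rewrite cmod0.
by apply: le_trans (cmodD _ _) _; rewrite lerD.
Qed.

Lemma cmod_prod (I : Type) (r : seq I) (P : pred I) (F : I -> R[i]) :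
  cmod (\prod_(i <- r | P i) F i) = \prod_(i <- r | P i) cmod (F i).
Proof.
by elim/big_ind2: _ => [|x1 x2 y1 y2 <- <-|//]; rewrite ?cmod1 ?cmodM.
Qed.

(** Radii of norm balls are elements of [R[i]]; a positive one is real, so all later estimates can
    run on real radii. *)
Lemma nbhs_cmodP p (A : set R[i]) :
  nbhs p A <-> exists2 d, 0 < d & forall z, cmod (z - p) < d -> A z.
Proof.
split=> [/nbhs_normP[e /= e0 eA]|[d d0 dA]].
  exists (complex.Re e); first by move: e0; rewrite ltcE => /andP[].
  have eE : e = (complex.Re e)%:C%C by rewrite RRe_real// gtr0_real.
  by move=> z zd; apply: eA => /=; rewrite normCE cmodB eE ltcR.
apply/nbhs_normP; exists d%:C%C; first by rewrite /= ltcR.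
by move=> z /=; rewrite normCE ltcR cmodB; exact: dA.
Qed.

Lemma near_cmod p d : 0 < d -> \forall z \near p, cmod (z - p) < d.
Proof. by move=> d0; apply/nbhs_cmodP; exists d. Qed.

Lemma cmod_lipschitz_continuous (g : R[i] -> R) :
  (forall z w, `|g z - g w| <= cmod (z - w)) -> continuous g.
Proof.
move=> gl z A /= /nbhs_ballP[e e0 eA]; apply/nbhs_cmodP; exists e => // w.
by rewrite cmodB => zw; apply: eA; apply: le_lt_trans zw.
Qed.

Lemma cmod_continuous : continuous (@cmod R).
Proof. exact/cmod_lipschitz_continuous/cmod_sub. Qed.

Lemma Re_continuous : continuous (@complex.Re R).
Proof.
apply: cmod_lipschitz_continuous => -[a b] [c d].
exact: (Re_le_cmod ((a +i* b) - (c +i* d))%C).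
Qed.

Lemma Im_continuous : continuous (@complex.Im R).
Proof.
apply: cmod_lipschitz_continuous => -[a b] [c d].
exact: (Im_le_cmod ((a +i* b) - (c +i* d))%C).
Qed.

Lemma Complex_continuous :
  continuous (fun xy : R * R => Complex xy.1 xy.2 : R[i]).
Proof.
move=> [x y] A /= /nbhs_cmodP[d d0 dA].
exists (ball x (d / 2), ball y (d / 2)) => /=.
  by split; apply: nbhsx_ballx; rewrite divr_gt0.
move=> [s t] [/= xs yt]; apply: dA; apply: le_lt_trans (cmod_le_ReIm _) _.
rewrite /= (splitr d) -(opprB x) -(opprB y) !normrN ltrD//.
Qed.

Lemma cmod_bounded_closed_compact (A : set R[i]) M :
  (forall z, A z -> cmod z <= M) -> closed A -> compact A.
Proof.
move=> AM Acl.
apply: (@subclosed_compact _ _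
  ((fun xy : R * R => Complex xy.1 xy.2 : R[i]) @`
    (`[- M, M]%classic `*` `[- M, M]%classic))) => //.
  apply: continuous_compact.
    exact/continuous_subspaceT/Complex_continuous.
  by apply: compact_setX; exact: segment_compact.
move=> z /AM zM; exists (complex.Re z, complex.Im z); last by case: z {zM}.
rewrite /= !in_itv /= -!ler_norml.
by split; apply: le_trans zM; [exact: Re_le_cmod|exact: Im_le_cmod].
Qed.

Lemma hausdorff_complex : hausdorff_space R[i].
Proof. exact: norm_hausdorff. Qed.

Lemma cmod_bounded_setP (A : set R[i]) :
  bounded_set A <-> exists M, forall z, A z -> cmod z <= M.
Proof.
split=> [[M [Mreal MA]]|[M AM]].
  exists (complex.Re M + 1) => z Az.
  have -> : complex.Re M + 1 = complex.Re (M + 1) by case: (M).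
  have M1 : M < M + 1 by rewrite ltrDl.
  have : `|z| <= M + 1 by exact: MA Az.
  by rewrite normCE lecE => /andP[].
exists M%:C%C; split; first by rewrite complex_real.
move=> x Mx z /AM zM; have : `|z| <= x; last by [].
by rewrite normCE; apply: le_trans (ltW Mx); rewrite lecR.
Qed.

End Modulus.

(** * Goursat's lemma for Riemann sums *)

Section Goursat.
Variable R : realType.
Implicit Types (u v : R[i] -> R[i]) (z w p a d : R[i]) (l e : R).

(** The left-endpoint Riemann sum, with [2 ^ n] steps, of the integral of [u] from [a] to [a + d];
    powers of two make halving a segment exact. *)
Definition segsum u (n : nat) d a : R[i] :=
  d / 2 ^+ n * \sum_(j < 2 ^ n) u (a + j%:R * (d / 2 ^+ n)).

(** Bottom, top, right and left sides of the square with lower left corner [a] and side [l]. All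
    sides are sampled rightwards or upwards and only then signed, so a side shared by two squares
    cancels exactly for every [n]. *)
Definition contour u (n : nat) a l : R[i] :=
  segsum u n l%:C%C a - segsum u n l%:C%C (a + 'i%C * l%:C%C)
  + segsum u n ('i%C * l%:C%C) (a + l%:C%C) - segsum u n ('i%C * l%:C%C) a.

Lemma exp2_neq0 n : 2 ^+ n != 0 :> R[i].
Proof. by rewrite expf_neq0// pnatr_eq0. Qed.

Lemma segsum_split u n d a :
  segsum u n.+1 d a = segsum u n (d / 2) a + segsum u n (d / 2) (a + d / 2).
Proof.
rewrite /segsum.
have -> : d / 2 ^+ n.+1 = d / 2 / 2 ^+ n by rewrite exprS invfM mulrA.
rewrite expnS mul2n -addnn big_split_ord /= -mulrDr; congr (_ * (_ + _)).
by apply: eq_bigr => j _; congr u; rewrite natrD natrX; field; exact: exp2_neq0.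
Qed.

Lemma segsumD u v n d a :
  segsum (fun z => u z + v z) n d a = segsum u n d a + segsum v n d a.
Proof. by rewrite /segsum big_split mulrDr. Qed.

Lemma segsumZ c u n d a :
  segsum (fun z => c * u z) n d a = c * segsum u n d a.
Proof. by rewrite /segsum -mulr_sumr mulrCA. Qed.

Lemma segsum_cst c n d a : segsum (fun=> c) n d a = d * c.
Proof.
rewrite /segsum sumr_const card_ord -[c *+ _]mulr_natl natrX mulrA mulfVK//.
Qed.

Lemma segsum_id n : exists K : R[i], forall d a,
  segsum id n d a = d * a + d ^+ 2 * K.
Proof.
exists ((\sum_(j < 2 ^ n) j%:R) / 2 ^+ n / 2 ^+ n) => d a.
rewrite /segsum big_split /= sumr_const card_ord -mulr_suml.
rewrite -[a *+ _]mulr_natl natrX; field; exact: exp2_neq0.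
Qed.

Lemma segsum_bound u n d a B :
  (forall t : R, 0 <= t <= 1 -> cmod (u (a + t%:C%C * d)) <= B) ->
  cmod (segsum u n d a) <= cmod d * B.
Proof.
move=> uB; rewrite /segsum !cmodM cmodV cmodX -mulrA ler_wpM2l ?cmod_ge0//.
rewrite cmod_nat mulrC ler_pdivrMr ?exprn_gt0//.
apply: le_trans (cmod_sum _ _ _) _.
have -> : B * 2 ^+ n = \sum_(j < 2 ^ n) B.
  by rewrite sumr_const card_ord -[RHS]mulr_natr natrX.
apply: ler_sum => j _.
have -> : j%:R * (d / 2 ^+ n) = (j%:R / 2 ^+ n)%:C%C * d :> R[i].
  by rewrite rmorphM fmorphV rmorphXn !rmorph_nat; ring.
apply: uB; rewrite divr_ge0//=.
by rewrite ler_pdivrMr ?exprn_gt0// mul1r -natrX ler_nat ltnW.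
Qed.

Lemma contourD u v n a l :
  contour (fun z => u z + v z) n a l = contour u n a l + contour v n a l.
Proof. by rewrite /contour !segsumD; ring. Qed.

Lemma contourZ c u n a l :
  contour (fun z => c * u z) n a l = c * contour u n a l.
Proof. by rewrite /contour !segsumZ; ring. Qed.

(** The sums for [z] deviate from the integral by a term that depends on the vector [d] of a side
    but not on its position, so it cancels between opposite sides: the vanishing is exact, not just
    a limit. *)
Lemma contour_affine c k n a l :
  contour (fun z => c + k * z) n a l = 0.
Proof.
have [K KE] := segsum_id n.
rewrite (contourD (fun=> c) (fun z => k * z)) (contourZ k id) /contour.
rewrite !segsum_cst !KE.
have i2 : 'i%C ^+ 2 = -1 :> R[i] by rewrite sqr_i.
by ring: i2.
Qed.

Lemma half_C l : l%:C%C / 2 = (l / 2)%:C%C :> R[i].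
Proof. by rewrite rmorphM fmorphV rmorph_nat. Qed.

Lemma contour_split u n a l (h := l / 2) :
  contour u n.+1 a l = contour u n a h + contour u n (a + h%:C%C) h
    + contour u n (a + 'i%C * h%:C%C) h
    + contour u n (a + h%:C%C + 'i%C * h%:C%C) h.
Proof.
rewrite /contour !segsum_split -!(mulrA 'i%C) !half_C -/h.
have lh : l%:C%C = h%:C%C + h%:C%C :> R[i] by rewrite -rmorphD -splitr.
rewrite lh !mulrDr !addrA.
set H := h%:C%C; set V := 'i%C * H.
rewrite (addrAC (a + V) V H) (addrAC a V H) (addrAC (a + H) V H).
ring.
Qed.

Definition square a l : set R[i] := [set z |
  (complex.Re a <= complex.Re z <= complex.Re a + l) /\
  (complex.Im a <= complex.Im z <= complex.Im a + l)].

Definition square_bd a l : set R[i] := [set z | square a l z /\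
  [\/ complex.Re z = complex.Re a, complex.Re z = complex.Re a + l,
      complex.Im z = complex.Im a | complex.Im z = complex.Im a + l]].

Lemma contour_bound u n a l B : 0 <= l ->
  (forall z, square_bd a l z -> cmod (u z) <= B) ->
  cmod (contour u n a l) <= 4 * l * B.
Proof.
move=> l0 uB.
have cl : cmod (l%:C%C : R[i]) = l by rewrite cmodC ger0_norm.
have tl (t : R) : 0 <= t <= 1 -> 0 <= t * l <= l.
  by move=> /andP[t0 t1]; apply/andP; split; nra.
have H b : b = a \/ b = a + 'i%C * l%:C%C ->
    cmod (segsum u n l%:C%C b) <= l * B.
  move=> bE; have := @segsum_bound u n l%:C%C b B.
  rewrite cl; apply => t /tl tlE.
  apply: uB; case: bE => ->; case: (a) => x y; rewrite /square_bd /square /=;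
    simpc; (split; first by split; apply/andP; split; lra).
    by apply: Or43; lra.
  by apply: Or44; lra.
have V b : b = a \/ b = a + l%:C%C ->
    cmod (segsum u n ('i%C * l%:C%C) b) <= l * B.
  move=> bE; have := @segsum_bound u n ('i%C * l%:C%C) b B.
  rewrite cmodM cmodi mul1r cl; apply => t /tl tlE.
  apply: uB; case: bE => ->; case: (a) => x y; rewrite /square_bd /square /=;
    simpc; (split; first by split; apply/andP; split; lra).
    by apply: Or41; lra.
  by apply: Or42; lra.
have := H a (or_introl erefl); have := H _ (or_intror erefl).
have := V a (or_introl erefl); have := V _ (or_intror erefl).
rewrite /contour; set A := segsum _ _ _ _; set B1 := segsum _ _ _ _.
set D := segsum _ _ _ _; set C := segsum _ _ _ _ => h1 h2 h3 h4.
have := cmodD (C - D + A) (- B1); have := cmodD (C - D) A.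
have := cmodD C (- D); rewrite !cmodN; lra.
Qed.

(** Caratheodory's form of complex differentiability: [phi] extends the difference quotient
    continuously to [p]. *)
Definition cdiff u p := exists2 phi : R[i] -> R[i],
  {for p, continuous phi} & \forall w \near p, u w - u p = phi w * (w - p).

Lemma square_diam a l z w : square a l z -> square a l w ->
  cmod (z - w) <= 2 * l.
Proof.
case: a => ax ay; case: z => zx zy; case: w => wx wy.
rewrite /square /= => -[/andP[? ?] /andP[? ?]] [/andP[? ?] /andP[? ?]].
apply: le_trans (cmod_le_ReIm _) _ => /=; rewrite mulr_natl mulr2n.
by apply: lerD; rewrite ler_norml; apply/andP; split; lra.
Qed.

(** The affine part of [u] at [p] has contour sum zero, and the rest is at most [e / 8 * (2 * l)]
    over a perimeter [4 * l]. The radius does not depend on [n], which the bisection needs. *)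
Lemma contour_small u p e : cdiff u p -> 0 < e ->
  exists2 d : R, 0 < d & forall a l, 0 < l < d -> square a l p ->
    forall n, cmod (contour u n a l) <= e * l ^+ 2.
Proof.
move=> [phi cphi uE] e0.
have e8 : 0 < e / 8 by rewrite divr_gt0.
have : \forall w \near p, cmod (phi w - phi p) < e / 8.
  exact: cphi (near_cmod (phi p) e8).
move=> nphi; have [d d0 dP] := (nbhs_cmodP p _).1 (filterI uE nphi).
exists (d / 2) => [|a l /andP[l0 ld] pl n]; first by rewrite divr_gt0.
pose r z := u z - ((u p - phi p * p) + phi p * z).
have -> : contour u n a l = contour r n a l.
  transitivity (contour (fun z => r z + ((u p - phi p * p) + phi p * z)) n a l).
    by congr contour; apply/funext => z; rewrite /r subrK.
  by rewrite contourD contour_affine addr0.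
have -> : e * l ^+ 2 = 4 * l * (e / 8 * (2 * l)) by field.
apply: contour_bound; first exact: ltW.
move=> z [zl _]; have zp := square_diam zl pl.
have zd : cmod (z - p) < d by apply: le_lt_trans zp _; lra.
have [uz phiz] := dP _ zd.
have -> : r z = (phi z - phi p) * (z - p).
  by rewrite mulrBl -uz /r; ring.
by rewrite cmodM ler_pM ?cmod_ge0// ltW.
Qed.

Lemma nested_intervals (x l : nat -> R) :
  (forall k, x k <= x k.+1) -> (forall k, x k.+1 + l k.+1 <= x k + l k) ->
  (forall k, 0 <= l k) -> exists q, forall k, x k <= q <= x k + l k.
Proof.
move=> xS xlS l0.
have xle j m : x j <= x (j + m)%N.
  elim: m => [|m IH]; rewrite ?addn0// addnS; exact: le_trans (xS _).
have lle j m : x (j + m)%N + l (j + m)%N <= x j + l j.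
  elim: m => [|m IH]; rewrite ?addn0// addnS; exact: le_trans (xlS _) IH.
have ub j k : x j <= x k + l k.
  have [/subnKC jk|/ltnW/subnKC kj] := leqP j k.
    by have := xle j (k - j)%N; rewrite jk => /le_trans; apply; rewrite lerDl.
  by have := lle k (j - k)%N; rewrite kj; apply: le_trans; rewrite lerDl.
have ubs k : ubound (range x) (x k + l k) by move=> _ [j _ <-].
exists (sup (range x)) => k; apply/andP; split.
  by apply: ub_le_sup; [exists (x 0%N + l 0%N)|exists k].
by apply: ge_sup => //; exists (x 0%N), 0%N.
Qed.

Lemma half_pow_small (L d : R) : 0 < d -> exists k, L / 2 ^+ k < d.
Proof.
move=> d0; set b := Num.bound `|L / d|; exists b.
rewrite ltr_pdivrMr ?exprn_gt0// mulrC -ltr_pdivrMr//.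
apply: le_lt_trans (ler_norm _) _.
apply: lt_trans (archi_boundP (normr_ge0 _)) _.
by rewrite -/b -natrX ltr_nat ltn_expl.
Qed.

(* Bisection: if the estimate fails on a square for all fine subdivisions, it
   fails on one of its quarters, and so on down to a point of
   differentiability. *)
Theorem goursat u a L e : 0 < L -> (forall z, square a L z -> cdiff u z) ->
  0 < e -> exists n0, forall n, (n0 <= n)%N ->
    cmod (contour u n a L) <= e * L ^+ 2.
Proof.
move=> L0 uD e0.
pose good b l := exists n0, forall n, (n0 <= n)%N ->
    cmod (contour u n b l) <= e * l ^+ 2.
apply: contrapT => bad.
have quarter b l : ~ good b l -> exists c, ~ good c (l / 2) /\
    (c = b \/ c = b + (l / 2)%:C%C \/ c = b + 'i%C * (l / 2)%:C%C \/
     c = b + (l / 2)%:C%C + 'i%C * (l / 2)%:C%C).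
  move=> nb; apply: contrapT => /forallNP ng; apply: nb.
  have gd c : (c = b \/ c = b + (l / 2)%:C%C \/ c = b + 'i%C * (l / 2)%:C%C \/
     c = b + (l / 2)%:C%C + 'i%C * (l / 2)%:C%C) -> good c (l / 2).
    by move=> cE; apply: contrapT => cg; exact: (ng c).
  have [n1 h1] := gd b (or_introl erefl).
  have [n2 h2] := gd _ (or_intror (or_introl erefl)).
  have [n3 h3] := gd _ (or_intror (or_intror (or_introl erefl))).
  have [n4 h4] := gd _ (or_intror (or_intror (or_intror erefl))).
  (* The successor pays for the one subdivision spent in cutting the square into quarters. *)
  exists (maxn (maxn n1 n2) (maxn n3 n4)).+1 => -[//|n].
  rewrite ltnS !geq_max => /andP[/andP[k1 k2] /andP[k3 k4]].
  rewrite contour_split.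
  have := h1 n k1; have := h2 n k2; have := h3 n k3; have := h4 n k4.
  set A := contour _ _ _ _; set B1 := contour _ _ _ _.
  set C := contour _ _ _ _; set D := contour _ _ _ _ => g1 g2 g3 g4.
  have := cmodD (D + C + B1) A; have := cmodD (D + C) B1.
  have := cmodD D C.
  have -> : e * l ^+ 2 = e * (l / 2) ^+ 2 *+ 4 by field.
  lra.
(* The choice function returns the corner of a bad quarter; its position is recorded by coordinates
   so that nested intervals apply to real and imaginary parts separately. *)
have /choice[g gP] (s : R[i] * R) : exists c, ~ good s.1 s.2 ->
    ~ good c (s.2 / 2) /\
    (complex.Re c = complex.Re s.1 \/
     complex.Re c = complex.Re s.1 + s.2 / 2) /\
    (complex.Im c = complex.Im s.1 \/
     complex.Im c = complex.Im s.1 + s.2 / 2).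
  case: s => b l /=.
  have [gb|nb] := pselect (good b l); first by exists 0.
  have [c [nc cE]] := quarter b l nb; exists c => _; split=> //.
  move: cE; case: (b) => x y.
  by move=> [->|[->|[->|->]]]; simpc => /=; split; tauto.
pose st k := iter k (fun s => (g s, s.2 / 2)) (a, L).
have stb k : ~ good (st k).1 (st k).2.
  by elim: k => [//|k IH]; have [] := gP _ IH.
have st2 k : (st k).2 = L / 2 ^+ k.
  elim: k => [|k IH]; first by rewrite /= expr0 divr1.
  by rewrite /= -/(st k) IH exprSr invfM mulrA.
have st20 k : 0 <= (st k).2 by rewrite st2 divr_ge0 ?exprn_ge0// ltW.
have [px pxP] : exists q, forall k,
    complex.Re (st k).1 <= q <= complex.Re (st k).1 + (st k).2.
  apply: nested_intervals => // k; have [_ [+ _]] := gP _ (stb k);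
    have := st20 k; rewrite /= -/(st k) => ? []->; lra.
have [py pyP] : exists q, forall k,
    complex.Im (st k).1 <= q <= complex.Im (st k).1 + (st k).2.
  apply: nested_intervals => // k; have [_ [_ +]] := gP _ (stb k);
    have := st20 k; rewrite /= -/(st k) => ? []->; lra.
have sqp k : square (st k).1 (st k).2 (Complex px py) by split.
have [d d0 dP] := contour_small (uD _ (sqp 0%N)) e0.
have [k kd] := half_pow_small L d0.
apply: (stb k); exists 0%N => n _; apply: dP => //.
by rewrite st2 kd divr_gt0 ?exprn_gt0.
Qed.

End Goursat.

(** * Complex differentiability in Caratheodory's form *)

Section ComplexDifferentiability.
Variable R : realType.
Implicit Types (u v h : R[i] -> R[i]) (z w p : R[i]).

(* [continuousD] and the like, with the pointwise operations unfolded. *)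
Lemma ccontD u v p : {for p, continuous u} -> {for p, continuous v} ->
  {for p, continuous (fun z => u z + v z)}.
Proof. exact: continuousD. Qed.

Lemma ccontM u v p : {for p, continuous u} -> {for p, continuous v} ->
  {for p, continuous (fun z => u z * v z)}.
Proof. exact: continuousM. Qed.

Lemma ccontN u p : {for p, continuous u} ->
  {for p, continuous (fun z => - u z)}.
Proof. exact: continuousN. Qed.

Lemma ccontV u p : u p != 0 -> {for p, continuous u} ->
  {for p, continuous (fun z => (u z)^-1)}.
Proof. exact: continuousV. Qed.

Lemma ccont_cst c p : {for p, continuous (fun=> c : R[i])}.
Proof. exact: cst_continuous. Qed.

Lemma ccont_id p : {for p, continuous (fun z : R[i] => z)}.
Proof. exact: id. Qed.

Lemma cdiff_continuous u p : cdiff u p -> {for p, continuous u}.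
Proof.
move=> [phi cphi uE].
have : {for p, continuous (fun w => u p + phi w * (w - p))}.
  apply: (@ccontD (fun=> u p) (fun w => phi w * (w - p))).
    exact: ccont_cst.
  apply: (@ccontM phi (fun w => w - p)); first exact: cphi.
  by apply: (@ccontD id (fun=> - p)); [exact: ccont_id|exact: ccont_cst].
rewrite /prop_for /continuous_at subrr mulr0 addr0.
move=> gu A /gu gA.
have {}gA : \forall w \near p, A (u p + phi w * (w - p)) by [].
suff : \forall w \near p, A (u w) by [].
near=> w.
have -> : u w = u p + phi w * (w - p) by rewrite -(near uE w)// subrKC.
by near: w.
Unshelve. all: by end_near. Qed.

Lemma cdiff_cst c p : cdiff (fun=> c) p.
Proof.
exists (fun=> 0); first exact: ccont_cst.
by apply: filterE => w; rewrite subrr mul0r.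
Qed.

Lemma cdiff_id p : cdiff id p.
Proof.
exists (fun=> 1); first exact: ccont_cst.
by apply: filterE => w; rewrite mul1r.
Qed.

Lemma cdiffD u v p : cdiff u p -> cdiff v p -> cdiff (fun z => u z + v z) p.
Proof.
move=> [f cf uE] [g cg vE]; exists (fun z => f z + g z).
  exact: (ccontD cf cg).
near=> w; rewrite mulrDl -(near uE w)// -(near vE w)//; ring.
Unshelve. all: by end_near. Qed.

Lemma cdiffM u v p : cdiff u p -> cdiff v p -> cdiff (fun z => u z * v z) p.
Proof.
move=> [f cf uE] dv; have cv := cdiff_continuous dv; case: dv => g cg vE.
exists (fun z => f z * v z + u p * g z).
  apply: (@ccontD (fun z => f z * v z) (fun z => u p * g z)).
    exact: (ccontM cf cv).
  by apply: (@ccontM (fun=> u p) g); [exact: ccont_cst|exact: cg].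
near=> w; have uw := near uE w; have vw := near vE w.
transitivity ((u w - u p) * v w + u p * (v w - v p)); first ring.
by rewrite uw// vw//; ring.
Unshelve. all: by end_near. Qed.

Lemma cdiffX u n p : cdiff u p -> cdiff (fun z => u z ^+ n) p.
Proof.
move=> du; elim: n => [|n IH]; first exact: cdiff_cst.
have -> : (fun z => u z ^+ n.+1) = (fun z => u z * u z ^+ n).
  by apply/funext => z; rewrite exprS.
exact: cdiffM.
Qed.

Lemma cdiff_neq0 u p : cdiff u p -> u p != 0 -> \forall z \near p, u z != 0.
Proof.
move=> /cdiff_continuous cu up0.
rewrite -cmod_gt0 in up0.
have /nbhs_cmodP[d d0 dP] := cu _ (near_cmod (u p) up0).
apply/nbhs_cmodP; exists d => // z /dP /=; apply: contraTneq => ->.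
by rewrite sub0r cmodN ltxx.
Qed.

Lemma cdiffV u p : cdiff u p -> u p != 0 -> cdiff (fun z => (u z)^-1) p.
Proof.
move=> du up0; have cu := cdiff_continuous du; have nu := cdiff_neq0 du up0.
case: du => f cf uE; exists (fun z => - f z * ((u z)^-1 * (u p)^-1)).
  apply: (@ccontM (fun z => - f z) (fun z => (u z)^-1 * (u p)^-1)).
    exact: (ccontN cf).
  apply: (@ccontM (fun z => (u z)^-1) (fun=> (u p)^-1)).
    exact: (ccontV up0 cu).
  exact: ccont_cst.
near=> w; have uw : u w != 0 by near: w.
transitivity (- (u w - u p) * ((u w)^-1 * (u p)^-1)).
  by field; rewrite uw up0.
have -> : u w - u p = f w * (w - p) by near: w.
ring.
Unshelve. all: by end_near. Qed.

Lemma cdiff_linear c p : cdiff (fun z => z - c) p.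
Proof. exact: (cdiffD (cdiff_id p) (cdiff_cst (- c) p)). Qed.

Lemma cdiff_inv_linear c p : p != c -> cdiff (fun z => (z - c)^-1) p.
Proof. by move=> pc; apply: cdiffV; [exact: cdiff_linear|rewrite subr_eq0]. Qed.

(* The value 0 that division by zero gives at p is the right one. *)
Lemma cdiff_sqr_div h p : cdiff h p -> h p = 0 ->
  cdiff (fun z => h z ^+ 2 / (z - p)) p.
Proof.
move=> [f cf hE] hp; exists (fun z => f z * f z); first exact: (ccontM cf cf).
near=> w; rewrite hp expr0n mul0r subr0.
have -> : h w = f w * (w - p) by rewrite -(near hE w)// hp subr0.
have [->|wp] := eqVneq w p; first by rewrite subrr !mulr0 expr0n mul0r.
by field; rewrite subr_eq0.
Unshelve. all: by end_near. Qed.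

Lemma derivable_cdiff u p : derivable u p 1 -> cdiff u p.
Proof.
move=> du.
pose f z := if z == p then 'D_1 u p else (u z - u p) / (z - p).
exists f; last first.
  apply: filterE => w; rewrite /f; case: eqP => [->|/eqP wp].
    by rewrite !subrr mulr0.
  by rewrite mulfVK// subr_eq0.
have fp : f p = 'D_1 u p by rewrite /f eqxx.
rewrite /prop_for /continuous_at fp => A /nbhs_cmodP[e e0 eA].
have : \forall h \near 0^',
    cmod (h^-1 *: (u (h *: 1 + p) - u p) - 'D_1 u p) < e.
  exact: (du _ (near_cmod ('D_1 u p) e0)).
move=> /nbhs_cmodP[d d0 dP]; apply/nbhs_cmodP; exists d => // w wd.
apply: eA; rewrite /f; case: eqP => [_|/eqP wp].
  by rewrite subrr cmod0.
have := dP (w - p); rewrite subr0 => /(_ wd); rewrite subr_eq0 => /(_ wp).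
have -> : (w - p) *: (1 : R[i]) = w - p by exact: mulr1.
by rewrite subrK mulrC.
Qed.

End ComplexDifferentiability.

(** * The maximum principle on squares *)

Section MaximumModulus.
Variable R : realType.
Implicit Types (u f h : R[i] -> R[i]) (z w p x a d : R[i]) (r B M : R).

(** A Riemann sum is a mean of values of [d * u], so a pointwise lower bound passes to it for every
    [n]; [c] will carry the sign of a side. *)
Lemma segsum_Im_ge u n d a (c : R[i]) B :
  (forall t : R, 0 <= t <= 1 ->
    B <= complex.Im (c * (d * u (a + t%:C%C * d)))) ->
  B <= complex.Im (c * segsum u n d a).
Proof.
move=> uB.
have ImD z w : complex.Im (z + w) = complex.Im z + complex.Im w.
  by case: z; case: w.
have Imsum (F : 'I_(2 ^ n) -> R[i]) :
    complex.Im (\sum_j F j) = \sum_j complex.Im (F j).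
  exact: (big_morph _ ImD).
have Ims (s : R) z : complex.Im (s%:C%C * z) = s * complex.Im z.
  by case: z => z1 z2 /=; rewrite mul0r addr0.
have -> : c * segsum u n d a = ((2 ^+ n)^-1)%:C%C *
    \sum_(j < 2 ^ n) c * (d * u (a + (j%:R / 2 ^+ n)%:C%C * d)).
  rewrite /segsum -!mulr_sumr fmorphV rmorphXn rmorph_nat.
  have -> : \sum_(j < 2 ^ n) u (a + j%:R * (d / 2 ^+ n)) =
      \sum_(j < 2 ^ n) u (a + (j%:R / 2 ^+ n)%:C%C * d).
    apply: eq_bigr => j _; congr u.
    by rewrite rmorphM fmorphV rmorphXn !rmorph_nat; ring.
  ring.
rewrite Ims Imsum mulrC ler_pdivlMr ?exprn_gt0//.
have -> : B * 2 ^+ n = \sum_(j < 2 ^ n) B.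
  by rewrite sumr_const card_ord -[RHS]mulr_natr natrX.
apply: ler_sum => j _; apply: uB; rewrite divr_ge0//=.
by rewrite ler_pdivrMr ?exprn_gt0// mul1r -natrX ler_nat ltnW.
Qed.

(** This replaces the value [2 * pi * i] of the integral. Each signed side contributes imaginary
    part at least 1: at offset [s] from its midpoint, with |s| <= r, the integrand times the side
    has imaginary part [2 * r * r / (s ^+ 2 + r ^+ 2)]. *)
Lemma winding_ge n x r : 0 < r ->
  4 <= cmod (contour (fun z => (z - x)^-1) n (x - Complex r r) (2 * r)).
Proof.
move=> r0; set u := fun z => _; set a := x - _.
have key t : 0 <= t <= 1 ->
    1 <= 2 * r * (r / ((2 * t * r - r) ^+ 2 + r ^+ 2)).
  move=> /andP[t0 t1]; rewrite mulrA ler_pdivlMr ?mul1r; last first.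
    by rewrite ltr_wpDl ?sqr_ge0// exprn_gt0.
  have : 0 <= r ^+ 2 * (t * (1 - t)).
    by apply: mulr_ge0; [exact: sqr_ge0|apply: mulr_ge0; lra].
  nra.
have inv (y1 y2 : R) : (Complex y1 y2 : R[i])^-1 =
    Complex (y1 / (y1 ^+ 2 + y2 ^+ 2)) (- (y2 / (y1 ^+ 2 + y2 ^+ 2))) by [].
have side d b c : (forall t : R, 0 <= t <= 1 ->
    1 <= complex.Im (c * (d * u (b + t%:C%C * d)))) ->
    1 <= complex.Im (c * segsum u n d b).
  exact: segsum_Im_ge.
pose l := (2 * r)%:C%C : R[i].
have h1 : 1 <= complex.Im (1 * segsum u n l a).
  apply: side => t /key; rewrite /u /a /l.
  have -> : x - Complex r r + t%:C%C * (2 * r)%:C%C - x =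
     Complex (2 * t * r - r) (- r).
    by case: (x) => x1 x2; simpc; congr Complex; ring.
  rewrite mul1r inv; simpc => /= /le_trans; apply.
  by rewrite sqrrN.
have h2 : 1 <= complex.Im (- 1 * segsum u n l (a + 'i%C * l)).
  apply: side => t /key; rewrite /u /a /l.
  have -> : x - Complex r r + 'i%C * (2 * r)%:C%C + t%:C%C * (2 * r)%:C%C - x =
     Complex (2 * t * r - r) r.
    by case: (x) => x1 x2; simpc; congr Complex; ring.
  by rewrite mulN1r inv; simpc => /= /le_trans; apply; rewrite ?mulrN ?opprK.
have h3 : 1 <= complex.Im (1 * segsum u n ('i%C * l) (a + l)).
  apply: side => t /key; rewrite /u /a /l.
  have -> : x - Complex r r + (2 * r)%:C%C +
      t%:C%C * ('i%C * (2 * r)%:C%C) - x =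
     Complex r (2 * t * r - r).
    by case: (x) => x1 x2; simpc; congr Complex; ring.
  by rewrite mul1r inv addrC; simpc => /= /le_trans; apply.
have h4 : 1 <= complex.Im (- 1 * segsum u n ('i%C * l) a).
  apply: side => t /key; rewrite /u /a /l.
  have -> : x - Complex r r + t%:C%C * ('i%C * (2 * r)%:C%C) - x =
     Complex (- r) (2 * t * r - r).
    by case: (x) => x1 x2; simpc; congr Complex; ring.
  rewrite mulN1r inv sqrrN addrC; simpc => /= /le_trans; apply.
  by rewrite ?mulNr ?mulrN ?opprK.
apply: le_trans (Im_le_cmod _); apply: le_trans (ler_norm _).
rewrite /contour -/l; move: h1 h2 h3 h4; rewrite !mul1r !mulN1r.
case: (segsum _ _ _ _) => ? ?; case: (segsum _ _ _ _) => ? ?.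
case: (segsum _ _ _ _) => ? ?; case: (segsum _ _ _ _) => ? ? /=.
lra.
Qed.

Lemma square_bd_dist x r z : 0 < r -> square_bd (x - Complex r r) (2 * r) z ->
  r <= cmod (z - x) <= 2 * r.
Proof.
move=> r0; case: x => x1 x2; case: z => z1 z2.
rewrite /square_bd /square /= => -[[/andP[? ?] /andP[? ?]] bd].
apply/andP; split; last first.
  apply: le_trans (cmod_le_ReIm _) _ => /=; rewrite mulr_natl mulr2n.
  by apply: lerD; rewrite ler_norml; apply/andP; split; lra.
have [re im] := (Re_le_cmod (Complex z1 z2 - Complex x1 x2),
                 Im_le_cmod (Complex z1 z2 - Complex x1 x2)).
case: bd => bd; [apply: le_trans re|apply: le_trans re|
                 apply: le_trans im|apply: le_trans im];
  rewrite /= ler_normr; apply/orP; (try by left; lra); right; lra.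
Qed.

Lemma square_dist x r z : square (x - Complex r r) (2 * r) z ->
  cmod (z - x) <= 2 * r.
Proof.
case: x => x1 x2; case: z => z1 z2.
rewrite /square /= => -[/andP[? ?] /andP[? ?]].
apply: le_trans (cmod_le_ReIm _) _ => /=; rewrite mulr_natl mulr2n.
by apply: lerD; rewrite ler_norml; apply/andP; split; lra.
Qed.

(* Expanding the square in the contour sum of (f - f x)^2 / (z - x), which
   tends to 0 by Goursat, bounds |f x|^2 by 2 M^2 + 4 M |f x|. *)
Lemma center_le5 f x r M : 0 < r ->
  (forall z, square (x - Complex r r) (2 * r) z -> cdiff f z) ->
  (forall z, square_bd (x - Complex r r) (2 * r) z -> cmod (f z) <= M) ->
  cmod (f x) <= 5 * M.
Proof.
set a := x - _ => r0 fD fM; set F := f x.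
have r20 : 0 < 2 * r by rewrite mulr_gt0.
have uD z : square a (2 * r) z -> cdiff (fun z => (f z - F) ^+ 2 / (z - x)) z.
  move=> /fD fz; have dz := cdiffD fz (cdiff_cst (- F) z).
  have [->|zx] := eqVneq z x; last first.
    exact: cdiffM (cdiffX 2 dz) (cdiff_inv_linear zx).
  by apply: cdiff_sqr_div; rewrite ?subrr//; apply: cdiffD (cdiff_cst _ _);
    apply: fD; move: r0; rewrite /square /a; case: (x) => x1 x2 /= ?; split;
    apply/andP; split; lra.
have M0 : 0 <= M.
  apply: le_trans (cmod_ge0 _) (fM a _); rewrite /square_bd /square.
  by split; [split; apply/andP; split; lra|exact: Or41].
have bd k z : square_bd a (2 * r) z ->
    cmod (f z ^+ k * (z - x)^-1) <= M ^+ k / r.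
  move=> zb; have /andP[zr _] := square_bd_dist r0 zb.
  rewrite cmodM cmodX cmodV; apply: ler_pM;
    rewrite ?exprn_ge0 ?invr_ge0 ?cmod_ge0//.
    by apply: lerXn2r (fM _ zb); rewrite nnegrE ?cmod_ge0.
  by rewrite lef_pV2// posrE// (lt_le_trans r0).
suff key e : 0 < e -> 4 * cmod F ^+ 2 <= 8 * M ^+ 2 + 16 * M * cmod F + e.
  have : 4 * cmod F ^+ 2 <= 8 * M ^+ 2 + 16 * M * cmod F.
    by apply/ler_addgt0Pr => e /key.
  (* The quadratic inequality puts |F| below (2 + sqrt 6) M, and 2 + sqrt 6 is less than 5. *)
  have := cmod_ge0 F; nra.
move=> e0; have e'0 : 0 < e / (2 * r) ^+ 2 by rewrite divr_gt0// exprn_gt0.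
have [n nP] := goursat r20 uD e'0.
have := nP n (leqnn n); rewrite mulfVK ?gt_eqF ?exprn_gt0//.
have -> : (fun z => (f z - F) ^+ 2 / (z - x)) =
    (fun z => (f z ^+ 2 * (z - x)^-1 + (- (2 * F)) * (f z ^+ 1 * (z - x)^-1)) +
       F ^+ 2 * (z - x)^-1).
  by apply/funext => z; ring.
rewrite (contourD (fun z => f z ^+ 2 * (z - x)^-1 +
  (- (2 * F)) * (f z ^+ 1 * (z - x)^-1)) (fun z => F ^+ 2 * (z - x)^-1)).
rewrite (contourD (fun z => f z ^+ 2 * (z - x)^-1)).
rewrite !contourZ.
have h2 := contour_bound n (ltW r20) (bd 2).
have h1 := contour_bound n (ltW r20) (bd 1).
have h0 := winding_ge n x r0; rewrite -/a in h0.
set C2 := contour _ _ _ _ in h2 *; set C1 := contour _ _ _ _ in h1 *.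
set C0 := contour _ _ _ _ in h0 *.
have E2 : 4 * (2 * r) * (M ^+ 2 / r) = 8 * M ^+ 2 by field; rewrite gt_eqF.
have E1 : 4 * (2 * r) * (M ^+ 1 / r) = 8 * M by field; rewrite gt_eqF.
rewrite E2 in h2; rewrite E1 in h1 => ee.
have t1 : cmod (F ^+ 2 * C0) <= e + cmod C2 + cmod (2 * F * C1).
  set X := C2 + _ + _ in ee.
  have -> : F ^+ 2 * C0 = X - C2 + 2 * F * C1 by rewrite /X; ring.
  apply: le_trans (cmodD _ _) _; rewrite lerD2r.
  by apply: le_trans (cmodD _ _) _; rewrite cmodN lerD2r.
have t2 : cmod (2 * F * C1) <= 16 * M * cmod F.
  by rewrite !cmodM cmod_nat; have := cmod_ge0 F; nra.
have t3 : 4 * cmod F ^+ 2 <= cmod (F ^+ 2 * C0).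
  by rewrite cmodM cmodX mulrC ler_wpM2l// exprn_ge0// cmod_ge0.
lra.
Qed.

(** If [s] exceeded a positive [t], Bernoulli's inequality would make [(s / t) ^+ n] unbounded. It
    serves both to drop the factor 5 and to force [h] to vanish near clustering zeros. *)
Lemma tensor_power (s t c : R) : 0 <= s -> 0 <= t ->
  (forall n, s ^+ n <= c * t ^+ n) -> s <= t.
Proof.
move=> s0 t0 st; rewrite leNgt; apply/negP => ts.
have [t_eq0|tn0] := eqVneq t 0.
  have := st 1%N; rewrite t_eq0 !expr1 mulr0 => s_le0.
  by move: ts; rewrite t_eq0 ltNge s_le0.
have tp : 0 < t by rewrite lt_def tn0.
set q := s / t - 1.
have q0 : 0 < q by rewrite subr_gt0 ltr_pdivlMr// mul1r.
have bern n : 1 + n%:R * q <= (1 + q) ^+ n.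
  elim: n => [|n IH]; first by rewrite mul0r addr0.
  rewrite exprS -natr1; have n0 : (0 : R) <= n%:R by []; nra.
have qc n : (1 + q) ^+ n <= c.
  rewrite /q addrC subrK expr_div_n ler_pdivrMr ?exprn_gt0//.
have c0 : 0 <= c / q by rewrite divr_ge0 ?(ltW q0)//; apply: le_trans (qc 0%N).
have := archi_boundP c0; rewrite ltr_pdivrMr//.
have := bern (Num.bound (c / q)); have := qc (Num.bound (c / q)); lra.
Qed.

Theorem center_max f x r M : 0 < r ->
  (forall z, square (x - Complex r r) (2 * r) z -> cdiff f z) ->
  (forall z, square_bd (x - Complex r r) (2 * r) z -> cmod (f z) <= M) ->
  cmod (f x) <= M.
Proof.
move=> r0 fD fM.
have M0 : 0 <= M.
  apply: le_trans (cmod_ge0 _) (fM (x - Complex r r) _).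
  rewrite /square_bd /square.
  by split; [split; apply/andP; split; lra|exact: Or41].
apply: (@tensor_power _ _ 5) => //; first exact: cmod_ge0.
move=> n; rewrite -cmodX.
apply: (@center_le5 (fun z => f z ^+ n) x r (M ^+ n)) => // z zs.
  exact/cdiffX/fD.
by rewrite cmodX lerXn2r ?nnegrE ?cmod_ge0// fM.
Qed.

End MaximumModulus.

(** * Accumulating zeros *)

Section Zeros.
Variable R : realType.
Implicit Types (f h : R[i] -> R[i]) (z w x : R[i]) (d : R).

Definition zeros_cluster h x := forall d, 0 < d ->
  exists z, [/\ z != x, cmod (z - x) < d & h z = 0].

(** The remaining zeros are taken strictly closer to [x] than the first one, which keeps the list
    free of repetitions. *)
Lemma many_zeros h x : zeros_cluster h x -> forall N d, 0 < d ->
  exists s : seq R[i], [/\ size s = N, uniq s &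
    forall z, z \in s -> cmod (z - x) < d /\ h z = 0].
Proof.
move=> acc; elim=> [|N IH] d d0; first by exists [::].
have [z [zx zd hz]] := acc d d0.
have zx0 : 0 < cmod (z - x) by rewrite cmod_gt0 subr_eq0.
have [s [sN us sP]] := IH _ zx0.
exists (z :: s); split=> [|/=|w]; first by rewrite /= sN.
  by rewrite us andbT; apply/negP => /sP[]; rewrite ltxx.
rewrite in_cons => /orP[/eqP ->//|/sP[wz hw]].
by split=> //; exact: lt_trans zd.
Qed.

Lemma prod_sub_neq0 (s : seq R[i]) w : w \notin s ->
  \prod_(y <- s) (w - y) != 0.
Proof.
by move=> ws; rewrite prodf_seq_neq0; apply/allP => y ys /=;
  rewrite subr_eq0; apply: contraNneq ws => ->.
Qed.

Lemma cdiff_inv_prod (s : seq R[i]) w : w \notin s ->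
  cdiff (fun z => (\prod_(y <- s) (z - y))^-1) w.
Proof.
move=> ws; apply: cdiffV; last exact: prod_sub_neq0.
elim: s {ws} => [|y s IH].
  rewrite (_ : (fun z => _) = fun=> 1); first exact: cdiff_cst.
  by apply/funext => z; rewrite big_nil.
rewrite (_ : (fun z => _) = fun z => (z - y) * \prod_(y <- s) (z - y)).
  exact: cdiffM (cdiff_linear y w) IH.
by apply/funext => z; rewrite big_cons.
Qed.

(** At a zero [w] in the list, [uniq] leaves a single factor [z - w], and the square in the
    numerator absorbs it. *)
Lemma cdiff_sqr_div_prod h (s : seq R[i]) w : uniq s ->
  (forall y, y \in s -> h y = 0) -> cdiff h w ->
  cdiff (fun z => h z ^+ 2 * (\prod_(y <- s) (z - y))^-1) w.
Proof.
move=> us sh dh; have [ws|ws] := boolP (w \in s); last first.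
  exact: cdiffM (cdiffX 2 dh) (cdiff_inv_prod ws).
rewrite (_ : (fun z => _) = fun z => h z ^+ 2 / (z - w) *
    (\prod_(y <- rem w s) (z - y))^-1).
  apply: cdiffM; first exact: cdiff_sqr_div dh (sh _ ws).
  by apply: cdiff_inv_prod; rewrite mem_rem_uniq// !inE eqxx.
apply/funext => z.
by rewrite (perm_big _ (perm_to_rem ws))/= big_cons invfM mulrA.
Qed.

Lemma expr_size_le_prod (T : eqType) (t : seq T) (F : T -> R) c : 0 <= c ->
  (forall y, y \in t -> c <= F y) -> c ^+ size t <= \prod_(y <- t) F y.
Proof.
move=> c0; elim: t => [|y t IH] tF; first by rewrite big_nil.
rewrite big_cons exprS ler_pM ?exprn_ge0 ?tF ?mem_head// IH// => z zt.
by rewrite tF// in_cons zt orbT.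
Qed.

Lemma prod_le_expr_size (T : eqType) (t : seq T) (F : T -> R) c :
  (forall y, y \in t -> 0 <= F y <= c) -> \prod_(y <- t) F y <= c ^+ size t.
Proof.
elim: t => [|y t IH] tF; first by rewrite big_nil.
have /andP[Fy0 Fyc] := tF _ (mem_head y t).
have tF' i : i \in t -> 0 <= F i <= c.
  by move=> it; rewrite tF// in_cons it orbT.
rewrite big_cons exprS ler_pM ?IH// big_seq prodr_ge0// => i it.
by have /andP[] := tF' i it.
Qed.

(* If h has N zeros y in the disc of radius s about x, the maximum principle
   for h^2 / prod (z - y) on a square of half-side 5s around a point of that
   disc bounds |h|^2 there by M^2 (2/3)^N. *)
Theorem zeros_cluster_near0 h x : (\forall z \near x, cdiff h z) ->
  zeros_cluster h x -> \forall z \near x, h z = 0.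
Proof.
move=> dh acc; set M := cmod (h x) + 1.
have bh : \forall z \near x, cmod (h z) <= M.
  have /nbhs_cmodP[d d0 dP] :=
    cdiff_continuous (nbhs_singleton dh) (near_cmod (h x) (@ltr01 R)).
  apply/nbhs_cmodP; exists d => // z /dP /= hz.
  by have := cmod_triangle (h z) (h x) 0; rewrite !subr0 /M; lra.
have [d d0 dP] := (nbhs_cmodP x _).1 (filterI dh bh).
(* The square around [z] reaches at most [10 * s] from [z], so it stays within [11 * s < d] of
   [x]. *)
pose s := d / 20; have s0 : 0 < s by rewrite divr_gt0.
apply/nbhs_cmodP; exists s => // z zs.
apply/eqP; rewrite -cmod_eq0; apply/negPn/negP => hz0.
have hz : 0 < cmod (h z) by rewrite lt_def hz0 cmod_ge0.
suff key N : cmod (h z) ^+ 2 <= M ^+ 2 * (2 / 3) ^+ N.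
  suff : (1 : R) <= 2 / 3 by lra.
  apply: (@tensor_power _ _ _ (M ^+ 2 / cmod (h z) ^+ 2)) => // n.
  by rewrite expr1n mulrAC ler_pdivlMr ?exprn_gt0// mul1r.
have [t [tN ut tP]] := many_zeros acc N s0.
have [zt|zt] := boolP (z \in t).
  by have [_ hz'] := tP _ zt; move: hz; rewrite hz' cmod0 ltxx.
have M0 : 0 <= M by rewrite addr_ge0 ?cmod_ge0.
pose u w := h w ^+ 2 * (\prod_(y <- t) (w - y))^-1.
have s50 : 0 < 5 * s by rewrite mulr_gt0.
have uz : cmod (u z) <= M ^+ 2 * ((3 * s) ^+ N)^-1.
  apply: (center_max s50) => w wz.
    have wz10 := square_dist wz.
    apply: cdiff_sqr_div_prod => // [y /tP[]//|].
    have [|//] := dP w; apply: le_lt_trans (cmod_triangle w z x) _.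
    rewrite /s in zs wz10; lra.
  have /andP[wz5 wz10] := square_bd_dist s50 wz.
  have [_ hw] : cdiff h w /\ cmod (h w) <= M.
    apply: dP; apply: le_lt_trans (cmod_triangle w z x) _.
    rewrite /s in zs wz10; lra.
  rewrite /u cmodM cmodX cmodV cmod_prod; apply: ler_pM.
  - by rewrite exprn_ge0 ?cmod_ge0.
  - by rewrite invr_ge0 prodr_ge0// => y _; exact: cmod_ge0.
  - by rewrite lerXn2r ?nnegrE ?cmod_ge0.
  (* The boundary is at least [5 * s] away from [z], and [y] is less than [2 * s] away from it; the
     ratio [2 / 3] compares the latter distance with the difference. *)
  have wy y : y \in t -> 3 * s <= cmod (w - y).
    move=> /tP[yx _]; have := cmod_triangle w y z; have := cmod_triangle y x z.
    by rewrite (cmodB x z); lra.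
  have tpos : (3 * s) ^+ N <= \prod_(y <- t) cmod (w - y).
    by rewrite -tN; apply: expr_size_le_prod => //; rewrite mulr_ge0// ltW.
  by rewrite lef_pV2// posrE ?(lt_le_trans _ tpos) ?exprn_gt0 ?mulr_gt0.
have zprod : \prod_(y <- t) cmod (z - y) <= (2 * s) ^+ N.
  rewrite -tN; apply: prod_le_expr_size => y /tP[yx _].
  rewrite cmod_ge0 /=; have := cmod_triangle z x y.
  by rewrite (cmodB x y); lra.
have hzE : h z ^+ 2 = u z * \prod_(y <- t) (z - y).
  by rewrite /u mulfVK// prod_sub_neq0.
rewrite -cmodX hzE cmodM cmod_prod.
have -> : M ^+ 2 * (2 / 3) ^+ N = M ^+ 2 * ((3 * s) ^+ N)^-1 * (2 * s) ^+ N.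
  rewrite -mulrA -exprVn -exprMn; congr (_ * _ ^+ _); field.
  by rewrite gt_eqF.
by apply: ler_pM; rewrite ?cmod_ge0// prodr_ge0// => y _; exact: cmod_ge0.
Qed.

End Zeros.

(** * Openness of the modulus *)

Section OpenModulus.
Variable R : realType.
Implicit Types (f : R[i] -> R[i]) (z w x : R[i]) (d r : R).

Lemma square_bd_compact (a : R[i]) r : compact (square_bd a r).
Proof.
have cRe (D : set R) : closed D -> closed (@complex.Re R @^-1` D : set R[i]).
  by apply: (continuous_closedP _).1; exact: Re_continuous.
have cIm (D : set R) : closed D -> closed (@complex.Im R @^-1` D : set R[i]).
  by apply: (continuous_closedP _).1; exact: Im_continuous.
apply: (@cmod_bounded_closed_compact _ _ (cmod a + 2 * r)).
  move=> z [zs _].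
  have ra : square a r a.
    case: zs => /andP[h1 h2] /andP[h3 h4]; split; apply/andP; split; lra.
  have := square_diam zs ra; have := cmod_triangle z a 0; rewrite !subr0; lra.
have -> : square_bd a r =
   (@complex.Re R @^-1` [set t | complex.Re a <= t] `&`
    @complex.Re R @^-1` [set t | t <= complex.Re a + r] `&`
    (@complex.Im R @^-1` [set t | complex.Im a <= t] `&`
     @complex.Im R @^-1` [set t | t <= complex.Im a + r])) `&`
   (@complex.Re R @^-1` [set t | t = complex.Re a] `|`
    @complex.Re R @^-1` [set t | t = complex.Re a + r] `|`
    (@complex.Im R @^-1` [set t | t = complex.Im a] `|`
     @complex.Im R @^-1` [set t | t = complex.Im a + r])).
  apply/seteqP; split=> z /=.
    move=> [[/andP[h1 h2] /andP[h3 h4]] bd]; split=> //.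
    by case: bd; tauto.
  move=> [[[h1 h2] [h3 h4]] bd]; split; first by split; apply/andP.
  by case: bd => -[h|h]; [exact: Or41|exact: Or42|exact: Or43|exact: Or44].
by apply: closedI; [apply: closedI; apply: closedI|
  apply: closedU; apply: closedU]; first [apply: cRe|apply: cIm];
  first [exact: closed_ge|exact: closed_le|exact: closed_eq].
Qed.

(** Strict convexity of the disc: the parallelogram identity makes [cmod (z - w) ^+ 2] at most 0. *)
Lemma eq_of_cmodD_ge z w : cmod z <= cmod w -> 2 * cmod w <= cmod (z + w) ->
  z = w.
Proof.
move=> zw zDw; apply/eqP; rewrite -subr_eq0 -cmod_eq0 -sqrf_eq0.
apply/eqP/le_anti; rewrite sqr_ge0 andbT.
have par : cmod (z - w) ^+ 2 =
    2 * cmod z ^+ 2 + 2 * cmod w ^+ 2 - cmod (z + w) ^+ 2.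
  rewrite !cmod_sqr; case: (z) => z1 z2; case: (w) => w1 w2 /=; ring.
rewrite par; have := cmod_ge0 z; have := cmod_ge0 w; nra.
Qed.

(* On each small square around x, a boundary point w where |f w + f x| is
   largest must satisfy f w = f x, so f - f x has zeros accumulating at x. *)
Theorem max_near_cst f x : (\forall z \near x, cdiff f z) ->
  (\forall z \near x, cmod (f z) <= cmod (f x)) ->
  \forall z \near x, f z = f x.
Proof.
move=> df mf; have [d d0 dP] := (nbhs_cmodP x _).1 (filterI df mf).
have dfB : \forall z \near x, cdiff (fun z => f z - f x) z.
  apply/nbhs_cmodP; exists d => // z /dP[dfz _].
  exact: cdiffD dfz (cdiff_cst _ _).
suff acc : zeros_cluster (fun z => f z - f x) x.
  have /nbhs_cmodP[e e0 eP] := zeros_cluster_near0 dfB acc.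
  by apply/nbhs_cmodP; exists e => // z /eP /eqP; rewrite subr_eq0 => /eqP.
move=> e e0; pose r := Num.min d e / 3.
have r0 : 0 < r by rewrite divr_gt0// lt_min d0.
have [rd re] : 2 * r < d /\ 2 * r < e.
  have := ge_min d d e; have := ge_min e d e.
  rewrite !lexx orbT /= /r; set m := Num.min d e => h1 h2; split; lra.
set S := square_bd (x - Complex r r) (2 * r).
(* Maximizing the modulus of [f] itself would only give [cmod (f w) = cmod (f x)]; the shift by
   [f x] turns this into equality of values. *)
pose g w := cmod (f w + f x).
have fD z : square (x - Complex r r) (2 * r) z -> cdiff (fun z => f z + f x) z.
  move=> /square_dist zx; have [|dfz _] := dP z; first by lra.
  exact: cdiffD dfz (cdiff_cst _ _).
have [w wS wmax] : exists2 w, w \in S & forall t, t \in S -> g t <= g w.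
  apply: compact_EVT_max.
  - exists (x - Complex r r); rewrite /S /square_bd /square.
    by split; [split; apply/andP; split; lra|exact: Or41].
  - exact: square_bd_compact.
  - apply: continuous_in_subspaceT => z /set_mem -[zs _].
    have cz := cdiff_continuous (fD z zs).
    exact: (continuous_comp cz (@cmod_continuous R _)).
rewrite inE in wS; have /andP[w1 w2] := square_bd_dist r0 wS.
have [|_ fw] := dP w; first by lra.
exists w; split; [by rewrite -subr_eq0 -cmod_gt0; lra|lra|].
apply/eqP; rewrite subr_eq0; apply/eqP/eq_of_cmodD_ge => //.
have -> : 2 * cmod (f x) = cmod (f x + f x).
  have -> : f x + f x = (2 : R)%:C%C * f x by rewrite rmorph_nat; ring.
  by rewrite cmodM cmodC ger0_norm.
apply: (@center_max _ (fun z => f z + f x) x r) => // z zS.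
by apply: wmax; rewrite inE.
Qed.

Theorem min_near_cst f x : (\forall z \near x, cdiff f z) -> f x != 0 ->
  (\forall z \near x, cmod (f x) <= cmod (f z)) ->
  \forall z \near x, f z = f x.
Proof.
move=> df fx0 mf; have nf := cdiff_neq0 (nbhs_singleton df) fx0.
have [d d0 dP] := (nbhs_cmodP x _).1 (filterI (filterI df nf) mf).
have : \forall z \near x, (f z)^-1 = (f x)^-1.
  apply: (@max_near_cst (fun z => (f z)^-1)).
    by apply/nbhs_cmodP; exists d => // z /dP[[? ?] _]; exact: cdiffV.
  apply/nbhs_cmodP; exists d => // z /dP[[_ fz] mz].
  by rewrite !cmodV lef_pV2// posrE cmod_gt0.
move=> /nbhs_cmodP[e e0 eP]; apply/nbhs_cmodP; exists e => // z /eP.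
exact: invr_inj.
Qed.

Lemma line_continuous (y v : R[i]) : continuous (fun t : R => y + t%:C%C * v).
Proof.
move=> t A /nbhs_cmodP[e e0 eP].
have n0 : 0 < cmod v + 1 by rewrite ltr_wpDl// cmod_ge0.
apply/nbhs_ballP; exists (e / (cmod v + 1)); first by rewrite /= divr_gt0.
move=> s /=; rewrite /ball /= => st; apply: eP.
have -> : y + s%:C%C * v - (y + t%:C%C * v) = (s - t)%:C%C * v.
  by rewrite rmorphB; ring.
rewrite cmodM cmodC distrC.
have h : `|t - s| * (cmod v + 1) < e by rewrite -ltr_pdivlMr.
have := normr_ge0 (t - s); lra.
Qed.

(** By the two principles, every small disc around [x] contains points of smaller and of larger
    modulus; the intermediate value theorem applies on the segment joining them, which stays in the
    disc. *)
Theorem cmod_open f x d : (\forall z \near x, cdiff f z) -> f x != 0 ->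
  ~ (\forall z \near x, f z = f x) -> 0 < d ->
  exists2 eta : R, 0 < eta & forall zeta : R,
    cmod (f x) - eta < zeta < cmod (f x) + eta ->
    exists2 z, cmod (z - x) < d & cmod (f z) = zeta.
Proof.
move=> df fx0 ncst d0; have [d' d'0 dP] := (nbhs_cmodP x _).1 df.
pose r := Num.min d d'; have r0 : 0 < r by rewrite lt_min d0.
have [rd rd'] : r <= d /\ r <= d' by rewrite !ge_min !lexx orbT.
have [y1 y1r f1] : exists2 y, cmod (y - x) < r & cmod (f y) < cmod (f x).
  apply: contrapT => no; apply: ncst; apply: min_near_cst => //.
  apply/nbhs_cmodP; exists r => // z zr; rewrite leNgt; apply/negP => fz.
  by apply: no; exists z.
have [y2 y2r f2] : exists2 y, cmod (y - x) < r & cmod (f x) < cmod (f y).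
  apply: contrapT => no; apply: ncst; apply: max_near_cst => //.
  apply/nbhs_cmodP; exists r => // z zr; rewrite leNgt; apply/negP => fz.
  by apply: no; exists z.
exists (Num.min (cmod (f x) - cmod (f y1)) (cmod (f y2) - cmod (f x))).
  by rewrite lt_min !subr_gt0 f1.
move=> zeta zetaP.
have [z1 z2] : cmod (f y1) <= zeta /\ zeta <= cmod (f y2).
  move: zetaP; set m := Num.min _ _ => /andP[h1 h2].
  have [m1 m2] : m <= cmod (f x) - cmod (f y1) /\ m <= cmod (f y2) - cmod (f x).
    by rewrite !ge_min !lexx orbT.
  by split; lra.
pose p (t : R) := y1 + t%:C%C * (y2 - y1).
have pr t : 0 <= t <= 1 -> cmod (p t - x) < r.
  move=> /andP[t0 t1].
  have -> : p t - x = (1 - t)%:C%C * (y1 - x) + t%:C%C * (y2 - x).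
    by rewrite /p rmorphB rmorph1; ring.
  apply: le_lt_trans (cmodD _ _) _; rewrite !cmodM !cmodC.
  rewrite !ger0_norm ?subr_ge0//.
  have [t00|tn0] := eqVneq t 0; first by rewrite t00 subr0 mul1r mul0r addr0.
  have tp : 0 < t by rewrite lt_def tn0.
  nra.
have pc : continuous p by exact: line_continuous.
have : exists2 t, t \in `[0, 1] & cmod (f (p t)) = zeta.
  apply: (@IVT R (fun t => cmod (f (p t))) 0 1 zeta ler01).
    apply: continuous_in_subspaceT => t; rewrite inE /= in_itv /= => t01.
    have dft : cdiff f (p t) by apply: dP; exact: lt_le_trans (pr t t01) _.
    have cft := continuous_comp (cdiff_continuous dft) (@cmod_continuous R _).
    exact: (continuous_comp (pc t) cft).
  rewrite /p mul0r addr0 mul1r subrKC ge_min le_max z1 z2 orbT //.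
move=> [t]; rewrite in_itv /= => t01 ft; exists (p t) => //.
exact: lt_le_trans (pr t t01) rd.
Qed.

End OpenModulus.

(** * Compact and connected sets in the plane *)

Section PlaneTopology.
Variable R : realType.
Implicit Types (A C F K O Q X : set R[i]) (z w x y : R[i]) (d e r : R).

Lemma closure_cmodP A z :
  closure A z <-> forall d, 0 < d -> exists2 w, A w & cmod (w - z) < d.
Proof.
split=> [clA d d0|h B /nbhs_cmodP[d d0 dB]].
  by have [w [Aw wd]] := clA _ (near_cmod z d0); exists w.
by have [w Aw wd] := h d d0; exists w; split=> //; exact: dB.
Qed.

Lemma open_cmodP A : open A <->
  forall z, A z -> exists2 d, 0 < d & forall w, cmod (w - z) < d -> A w.
Proof.
rewrite openE; split=> h z Az; first exact/nbhs_cmodP/h.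
exact/nbhs_cmodP/h.
Qed.

Definition thickening A r : set R[i] :=
  [set z | exists2 w, A w & cmod (z - w) < r].

Lemma thickening_open A r : open (thickening A r).
Proof.
apply/open_cmodP => z [w Aw zw]; exists (r - cmod (z - w)).
  by rewrite subr_gt0.
by move=> y yz; exists w => //; have := cmod_triangle y z w; lra.
Qed.

Lemma closure_thickening A r z : closure (thickening A r) z -> 0 < r ->
  exists2 w, A w & cmod (z - w) < 2 * r.
Proof.
move=> /closure_cmodP h r0; have [y [w Aw yw] yz] := h r r0.
by exists w => //; have := cmod_triangle z y w; rewrite (cmodB z y); lra.
Qed.

Lemma sub_thickening A r : 0 < r -> A `<=` thickening A r.
Proof. by move=> r0 z Az; exists z => //; rewrite subrr cmod0. Qed.

Lemma closure_thickening_compact K (M : R) r : (forall z, K z -> cmod z <= M) ->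
  0 < r -> compact (closure (thickening K r)).
Proof.
move=> KM r0.
apply: (@cmod_bounded_closed_compact _ _ (M + 2 * r)).
  move=> z /closure_thickening/(_ r0)[w /KM wM zw].
  by have := cmod_triangle z w 0; rewrite !subr0; lra.
exact: closed_closure.
Qed.

(** [P] need not be monotone in [e], hence a local hypothesis for all small [e] at once. It supplies
    the uniform distance, the gap around a level and the uniform range of attained values. *)
Lemma compact_uniform K (P : R -> R[i] -> Prop) : compact K ->
  (forall x, K x -> exists2 d, 0 < d &
     forall w e, cmod (w - x) < d -> 0 < e < d -> P e w) ->
  exists2 e, 0 < e & forall w, K w -> P e w.
Proof.
move=> /compact_near_coveringP cK KP.
have : \forall e \near 0^'+, K `<=` P e.
  apply: cK => x /KP[d d0 dP].
  exists ([set w | cmod (w - x) < d], [set e | 0 < e < d]) => /=.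
    split; first exact: near_cmod.
    by near=> e; apply/andP; split; near: e;
      [exact: nbhs_right_gt|exact: nbhs_right_lt].
  by move=> [w e] /= [wx ed]; exact: dP.
move=> KPe; near (0 : R)^'+ => e; exists e.
  by near: e; exact: nbhs_right_gt.
by near: e.
Unshelve. all: by end_near. Qed.

Lemma compact_closed_dist K F : compact K -> closed F -> K `&` F = set0 ->
  exists2 e, 0 < e & forall k z, K k -> F z -> e <= cmod (k - z).
Proof.
move=> cK clF KF.
have [x Kx|e e0 eP] := @compact_uniform K
  (fun e k => forall z, F z -> e <= cmod (k - z)) cK; last first.
  by exists e => // k z /eP; apply.
have /open_cmodP/(_ x)[|d d0 dF] : open (~` F) by exact: closed_openC.
  by move=> Fx; have : (K `&` F) x by []; rewrite KF.
exists (d / 2) => [|w e wx /andP[_ ed] z Fz]; first by rewrite divr_gt0.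
rewrite leNgt; apply/negP => wz; apply: (dF z) => //.
by have := cmod_triangle z w x; rewrite (cmodB z w); lra.
Qed.

Lemma compact_net K r : compact K -> 0 < r -> exists s : seq R[i],
  (forall x, x \in s -> K x) /\
  forall y, K y -> exists2 x, x \in s & cmod (y - x) < r.
Proof.
move=> cK r0; have : cover_compact K by rewrite -compact_cover.
move=> /(_ _ K (fun x => thickening [set x] r)).
move=> [i _|y Ky|D DK Dcov]; first exact: thickening_open.
  by exists y => //; exact: sub_thickening.
exists (finmap.enum_fset D); split=> [x /DK|y /Dcov[x /= xD [_ -> yx]]].
  by rewrite inE.
by exists x.
Qed.

Lemma clopen_complex_setT A x : open A -> closed A -> A x -> A = setT.
Proof.
move=> oA cA Ax; apply/seteqP; split=> // z _.
have lc := @line_continuous R x (z - x).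
pose g (t : R) := x + t%:C%C * (z - x).
suff gT : g @^-1` A = setT.
  have : (g @^-1` A) 1 by rewrite gT.
  by rewrite /g /= mul1r subrKC.
have cR : connected [set: R].
  by apply/connected_intervalP => a b _ _ t _.
apply: cR.
- by exists 0; rewrite /g /= mul0r addr0.
- exists (g @^-1` A); last by rewrite setTI.
  by apply: open_comp => // t _; exact: lc.
- exists (g @^-1` A); last by rewrite setTI.
  by apply: preimage_closed => // t _; exact: lc.
Qed.

(* In a compact plane set, components are intersections of clopen sets. *)
Theorem component_clopen_nbhd X a O : compact X -> X a -> open O ->
  connected_component X a `<=` O ->
  exists C, [/\ closed C, closed (X `\` C), C `<=` X, C a & C `<=` O].
Proof.
move=> cX Xa oO aO; have clX := compact_closed (@hausdorff_complex R) cX.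
pose clop C := [/\ closed C, closed (X `\` C), C `<=` X & C a].
have clopX : clop X by split=> //; rewrite setDv; exact: closed0.
have clopI C D : clop C -> clop D -> clop (C `&` D).
  move=> [c1 c2 c3 c4] [d1 d2 d3 d4]; split=> //.
  - exact: closedI.
  - by rewrite setDIr; exact: closedU.
  - by move=> z [/c3].
pose Q := \bigcap_(C in clop) C.
have QC C : clop C -> Q `<=` C by move=> cC z; apply.
have clQ : closed Q by apply: closed_bigI => C [].
have shrink W : open W -> Q `<=` W -> exists2 C, clop C & C `<=` W.
  move=> oW QW; apply: contrapT => no.
  (* If no clopen set fitted into [W], compactness would give these sets a cluster point, lying in
     [Q] but outside [W]. *)
  have FF : ProperFilter (filter_from clop (fun C => C `&` ~` W)).
    apply: filter_from_proper.
      apply: filter_from_filter; first by exists X.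
      by move=> C D cC cD; exists (C `&` D); [exact: clopI|move=> z [[]]].
    move=> C cC; apply: contrapT => /forallNP CW.
    apply: no; exists C => // z Cz.
    by apply: contrapT => Wz; exact: (CW z).
  have FX : filter_from clop (fun C => C `&` ~` W) X by exists X => // z [].
  have [q [Xq clq]] := cX _ FF FX.
  have clq' C : clop C -> closure (C `&` ~` W) q.
    by move=> cC B /clq; apply; exists C.
  have Qq : Q q.
    by move=> C /[dup] cC [clC _ _ _]; apply: clC; have := clq' _ cC;
      apply: closureS => z [].
  have : (~` W) q.
    have /closure_id -> : closed (~` W) by exact: open_closedC.
    by have := clq' _ clopX; apply: closureS => z [].
  by apply; exact: QW.
(* Disjoint closed pieces of [Q] have disjoint thickenings. A clopen set inside their union, cut
   down to the thickening of [A1], remains clopen and contains [a], so it contains all of [Q]. *)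
have half A1 A2 : closed A1 -> closed A2 -> A1 `&` A2 = set0 ->
    Q = A1 `|` A2 -> A1 a -> A2 = set0.
  move=> cl1 cl2 A12 QA A1a.
  have cA1 : compact A1.
    apply: subclosed_compact cX _ => // z A1z; apply: (QC X) => //.
    by rewrite QA; left.
  have [e e0 eP] := compact_closed_dist cA1 cl2 A12.
  have e20 : 0 < e / 2 by rewrite divr_gt0.
  pose U1 := thickening A1 (e / 2); pose U2 := thickening A2 (e / 2).
  have U12 z : U1 z -> U2 z -> False.
    move=> [k A1k zk] [l A2l zl]; have := eP k l A1k A2l.
    by have := cmod_triangle k z l; rewrite (cmodB k z); lra.
  have [|z|C [c1 c2 c3 c4] CU] := shrink (U1 `|` U2).
  - by apply: openU; exact: thickening_open.
  - by rewrite QA => -[Az|Az]; [left|right]; exact: sub_thickening.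
  have clopC1 : clop (C `&` U1).
    split.
    - have -> : C `&` U1 = C `&` ~` U2.
        apply/seteqP; split=> z [Cz Uz]; split=> //.
          by move=> U2z; exact: (U12 z).
        by have [//|/Uz] := CU _ Cz.
      by apply: closedI => //; exact/open_closedC/thickening_open.
    - rewrite setDIr; apply: closedU => //; rewrite setDE.
      by apply: closedI => //; exact/open_closedC/thickening_open.
    - by move=> z [/c3].
    - by split=> //; exact: sub_thickening.
  rewrite -subset0 => z A2z; have : Q z by rewrite QA; right.
  move=> /(QC _ clopC1)[_ U1z]; apply: (U12 z) => //; exact: sub_thickening.
have cQ : connected Q.
  move=> B B0 [V oV BV] [D cD BD].
  have clB : closed B by rewrite BD; exact: closedI.
  have clQB : closed (Q `\` B).
    rewrite (_ : Q `\` B = Q `&` ~` V).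
      by apply: closedI => //; exact: open_closedC.
    rewrite BV; apply/seteqP; split=> z /=.
      by move=> [Qz nV]; split=> // Vz; exact: nV.
    by move=> [Qz nV]; split=> // -[].
  have QB : Q = B `|` Q `\` B.
    apply/seteqP; split=> z.
      by move=> Qz; have [Bz|Bz] := pselect (B z); [left|right].
    by case=> [|[]//]; rewrite BV => -[].
  have Qa : Q a by move=> C [].
  have [Ba|Ba] := pselect (B a).
    have /seteqP[QB0 _] : Q `\` B = set0.
      by apply: (half B) => //; apply/seteqP; split=> // z [Bz []].
    apply/seteqP; split=> z; first by rewrite BV => -[].
    by move=> Qz; apply: contrapT => Bz; exact: (QB0 z).
  have B0' : B = set0.
    by apply: (half (Q `\` B)) => //; [apply/seteqP; split=> // z [[]]|
      rewrite setUC].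
  by move: B0; rewrite B0' => -[].
have [|C [c1 c2 c3 c4] CO] := shrink O oO; last by exists C.
move=> z Qz; apply: aO; exists Q => //; split=> //; first by move=> C [].
exact: QC.
Qed.

End PlaneTopology.

(** * Meromorphic functions *)

Section Meromorphic.
Variables (R : realType) (f : R[i] -> option R[i]).
Implicit Types (z w p x : R[i]) (U : set R[i]).

Local Notation g := (finite_part f).

Lemma absf_finite z : f z <> None -> absf f z = (cmod (g z))%:E.
Proof. by rewrite /absf /finite_part; case: (f z). Qed.

Lemma holomorphic_cdiff p : (\forall z \near p, holomorphic_point f z) ->
  \forall z \near p, cdiff g z.
Proof.
move=> /nbhs_cmodP[d d0 dP]; apply/nbhs_cmodP; exists d => // z /dP[_].
exact: derivable_cdiff.
Qed.

(** At a pole the limit required by the definition is the value [+oo] itself, so continuity into the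
    extended reals holds there too. *)
Lemma absf_continuous U p : meromorphic U f -> U p ->
  {for p, continuous (absf f)}.
Proof.
move=> mf /mf[hp|[fp _ plim]].
  have cg := cdiff_continuous (nbhs_singleton (holomorphic_cdiff hp)).
  have ccg := continuous_comp cg (@cmod_continuous R _).
  have [fp _] := nbhs_singleton hp.
  move=> A; rewrite /prop_for (absf_finite fp) => /nbhs_EFin nA.
  have [d d0 dP] := (nbhs_cmodP p _).1 (filterI hp (ccg _ nA)).
  apply/nbhs_cmodP; exists d => // z /dP[[fz _] Az].
  by rewrite /= (absf_finite fz).
move=> A nA; have fpE : absf f p = +oo%E by rewrite /absf fp.
rewrite fpE in nA.
have /nbhs_cmodP[d d0 dP] := plim _ nA.
apply/nbhs_cmodP; exists d => // z zd; have [->|zp] := eqVneq z p.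
  by rewrite /= fpE; exact: nbhs_singleton nA.
exact: (dP z zd zp).
Qed.

Lemma finite_value_holomorphic U p (e : R) : meromorphic U f -> U p ->
  absf f p = e%:E -> \forall z \near p, holomorphic_point f z.
Proof. by move=> mf /mf[//|[fp _ _]]; rewrite /absf fp. Qed.

(* The interior of the set where f takes the value c is closed in G: at its
   limit points f is not a pole, and the zeros of f - c accumulate. *)
Lemma meromorphic_identity (G : set R[i]) p c : open G -> connected G ->
  meromorphic G f -> G p -> (\forall z \near p, f z = Some c) ->
  forall z, G z -> f z = Some c.
Proof.
move=> oG cG mf Gp nfp.
pose W := [set z : R[i] | \forall w \near z, f w = Some c].
have oW : open W.
  apply/open_cmodP => z /nbhs_cmodP[d d0 dP]; exists (d / 2).
    by rewrite divr_gt0.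
  move=> w wz; apply/nbhs_cmodP; exists (d / 2); first by rewrite divr_gt0.
  by move=> y yw; apply: dP; have := cmod_triangle y w z; lra.
suff WG : G `&` W = G.
  move=> z Gz; have [_ Wz] : (G `&` W) z by rewrite WG.
  exact: nbhs_singleton Wz.
apply: cG; [by exists p|by exists W|exists (closure W)].
  exact: closed_closure.
apply/seteqP; split=> q [Gq Wq]; split; [exact: Gq| |exact: Gq|].
  exact: subset_closure.
move/closure_cmodP in Wq; have [Wq'|nWq] := pselect (W q); first exact: Wq'.
have Wacc d : 0 < d -> exists z, [/\ z != q, cmod (z - q) < d & f z = Some c].
  move=> /Wq[z Wz zd]; exists z.
  split; [|exact: zd|exact: nbhs_singleton Wz].
  by apply/eqP => zq; apply: nWq; rewrite -zq.
clear nWq; have [hq|[_ _ plim]] := mf _ Gq.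
  have dg : \forall z \near q, cdiff (fun z => g z - c) z.
    have /nbhs_cmodP[d d0 dP] := holomorphic_cdiff hq.
    apply/nbhs_cmodP; exists d => // z /dP dz.
    exact: cdiffD dz (cdiff_cst _ _).
  have acc : zeros_cluster (fun z => g z - c) q.
    move=> d /Wacc[z [zq zd fz]]; exists z; split=> //.
    by rewrite /finite_part fz /= subrr.
  have gc := zeros_cluster_near0 dg acc.
  have [d d0 dP] := (nbhs_cmodP q _).1 (filterI hq gc).
  apply/nbhs_cmodP; exists d => // z /dP[[fz _] /eqP].
  rewrite subr_eq0 => /eqP <-.
  by move: fz; rewrite /finite_part; case: (f z).
have nA : nbhs (+oo%E : \bar R) [set t | ((cmod c)%:E < t)%E].
  by exists (cmod c); split=> [|t]; [exact: num_real|].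
have /nbhs_cmodP[d d0 dP] := plim _ nA.
have [z [zq zd fz]] := Wacc d d0.
have : ((cmod c)%:E < absf f z)%E by exact: dP z zd zq.
by rewrite /absf fz ltxx => /notF[].
Qed.

Lemma level_open U x (e d : R) : meromorphic U f -> open U -> U x -> 0 < e ->
  absf f x = e%:E -> ~ (\forall z \near x, f z = f x) -> 0 < d ->
  exists2 eta : R, 0 < eta & forall zeta : R, e - eta < zeta < e + eta ->
    exists z, [/\ U z, cmod (z - x) < d & absf f z = zeta%:E].
Proof.
move=> mf oU Ux e0 fx ncst d0.
have hx := finite_value_holomorphic mf Ux fx.
have [fxN _] := nbhs_singleton hx.
have gx : cmod (g x) = e by move: fx; rewrite (absf_finite fxN) => -[].
have nU : \forall z \near x, U z.
  by apply/nbhs_cmodP; exact: (open_cmodP _).1 _ Ux.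
have [d' d'0 dP] := (nbhs_cmodP x _).1 (filterI hx nU).
have ncst' : ~ (\forall z \near x, g z = g x).
  move=> ng; apply: ncst; have [r r0 rP] := (nbhs_cmodP x _).1 (filterI hx ng).
  apply/nbhs_cmodP; exists r => // z /rP[[+ _]]; move: fxN.
  by rewrite /finite_part; case: (f z) => // ?; case: (f x) => //= ? _ _ ->.
have [|||eta eta0 etaP] :=
  @cmod_open _ g x (Num.min d d') (holomorphic_cdiff hx).
- by rewrite -cmod_gt0 gx.
- by [].
- by rewrite lt_min d0.
exists eta => // zeta; rewrite -gx => /etaP[z].
rewrite lt_min => /andP[zd zd'] gz.
have [[fz _] Uz] := dP z zd'.
by exists z; split=> //; rewrite absf_finite// gz.
Qed.

End Meromorphic.

(** * Level curves *)

Section StandingAssumptions.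
Variables (R : realType) (G G' : set R[i]) (f : R[i] -> option R[i]).
Hypothesis hGf : standing_assumptions G G' f.
Implicit Types (z w p x : R[i]) (U L : set R[i]).

Lemma standing_sub : G `<=` G'.
Proof. by move=> z Gz; apply: (sa_closure_sub hGf); exact: subset_closure. Qed.

Lemma standing_meromorphic : meromorphic G f.
Proof. by move=> z /standing_sub; exact: (sa_meromorphic hGf). Qed.

Lemma level_curve_atE (e : R) Lambda x :
  is_component (level_set f G' e%:E) Lambda -> Lambda x ->
  level_curve_at f G' x = Lambda.
Proof.
move=> [x0 _ ->] Lx; have [_ fx] := connected_component_sub Lx.
by rewrite /level_curve_at fx -(same_connected_component Lx).
Qed.

Lemma bounded_component_not_near_cst (e : R) Lambda x :
  is_component (level_set f G' e%:E) Lambda -> bounded_set Lambda ->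
  Lambda `<=` G -> Lambda x -> ~ (\forall z \near x, f z = f x).
Proof.
move=> LC Lb LG Lx nf; have Gx := LG _ Lx.
have LE := level_curve_atE LC Lx.
have fx : absf f x = e%:E.
  by case: LC Lx => x0 _ -> /connected_component_sub[].
have [c fxc] : exists c, f x = Some c.
  by move: fx; rewrite /absf; case: (f x) => // c _; exists c.
rewrite fxc in nf.
have fG := meromorphic_identity (sa_open hGf) (sa_connected hGf)
  standing_meromorphic Gx nf.
have GL : G `<=` Lambda.
  rewrite -LE; apply: connected_component_max => //;
    last exact: sa_connected hGf.
  by move=> z Gz; split; [exact: standing_sub|rewrite /absf (fG _ Gz) fxc].
(* By [sa_level_curve_inside] at [x], the closure of [Lambda] lies in [G], and [G] is contained in
   [Lambda]. *)
have clG : closed G.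
  move=> z clz; apply: (sa_level_curve_inside hGf Gx); rewrite LE.
  by move: clz; exact: closureS.
have GT := clopen_complex_setT (sa_open hGf) clG Gx.
have /cmod_bounded_setP[M LM] := Lb.
have : cmod ((`|M| + 1)%:C%C : R[i]) <= M by apply: LM; apply: GL; rewrite GT.
rewrite cmodC ger0_norm ?addr_ge0//; have := ler_norm M; lra.
Qed.

(** The closure of [Lambda] stays in [G], where |f| is continuous, so it is a connected part of the
    same level set and cannot exceed the component. *)
Lemma bounded_component_compact (e : R) Lambda :
  is_component (level_set f G' e%:E) Lambda -> bounded_set Lambda ->
  Lambda `<=` G -> compact Lambda.
Proof.
move=> LC Lb LG; have /cmod_bounded_setP[M LM] := Lb.
apply: (cmod_bounded_closed_compact LM).
have [x0 Ex0 LE] := LC.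
have Lx0 : Lambda x0 by rewrite LE; exact: connected_component_refl.
have clG : closure Lambda `<=` G.
  rewrite -{1}(level_curve_atE LC Lx0).
  exact: sa_level_curve_inside (LG _ Lx0).
have cont z : closure Lambda z -> {for z, continuous (absf f)}.
  by move=> /clG/standing_sub; exact: absf_continuous (sa_meromorphic hGf).
move=> z clz; rewrite LE; exists (closure Lambda) => //; split.
- exact: subset_closure.
- move=> w clw; split; first exact/standing_sub/clG.
  apply: ereal_hausdorff => A B nA nB.
  have [y [Ly Ay]] := clw _ (cont w clw A nA).
  exists e%:E; split; last exact: nbhs_singleton nB.
  by move: Ly Ay; rewrite LE => /connected_component_sub[_ <-].
- by apply: connected_closure; rewrite LE; exact: component_connected.
Qed.

(* A compact neighbourhood meets the level set in a compact set, of which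
   Lambda is a component; a thin collar around a clopen piece of that set
   containing Lambda has no point of the level set on its boundary. *)
Lemma isolating_neighbourhood (e : R) Lambda (r : R) :
  is_component (level_set f G' e%:E) Lambda -> bounded_set Lambda ->
  Lambda `<=` G -> 0 < r ->
  exists U, [/\ open U, Lambda `<=` U, U `<=` G `&` thickening Lambda r,
    compact (closure U `\` U) &
    forall z, (closure U `\` U) z -> G' z /\ absf f z <> e%:E].
Proof.
move=> LC Lb LG r0; have cL := bounded_component_compact LC Lb LG.
have [x0 Ex0 LE] := LC.
have Lx0 : Lambda x0 by rewrite LE; exact: connected_component_refl.
have [|d d0 dP] := compact_closed_dist cL (open_closedC (sa_open hGf)).
  by rewrite -subset0 => z [/LG].
(* The closure of an [s]-thickening reaches less than [2 * s], and [2 * s <= d] keeps it inside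
   [G]. *)
pose s := Num.min d r / 2.
have s0 : 0 < s by rewrite divr_gt0// lt_min d0.
have [sd sr] : 2 * s <= d /\ s <= r.
  have := ge_min d d r; have := ge_min r d r.
  rewrite !lexx orbT /= /s; set m := Num.min d r => h1 h2; split; lra.
have /cmod_bounded_setP[M LM] := Lb.
set N0 := thickening Lambda s; set N := closure N0.
have cN : compact N := closure_thickening_compact LM s0.
have NG : N `<=` G.
  move=> z /closure_thickening/(_ s0)[w Lw zw]; apply: contrapT => Gz.
  by have := dP w z Lw Gz; rewrite cmodB; lra.
have N0N : N0 `<=` N by exact: subset_closure.
pose X := N `&` [set z | absf f z = e%:E].
have cX : compact X.
  have -> : X = N `&` closure X.
    apply/seteqP; split=> z [Nz Xz]; split=> //; first exact: subset_closure.
    apply: ereal_hausdorff => A B nA nB.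
    have cz := absf_continuous (sa_meromorphic hGf) (standing_sub (NG _ Nz)).
    have [y [[_ Xy] Ay]] := Xz _ (cz A nA).
    by exists e%:E; split; [rewrite -Xy|exact: nbhs_singleton nB].
  by apply: compact_closedI cN _; exact: closed_closure.
have LN0 : Lambda `<=` N0 by exact: sub_thickening.
have Lf z : Lambda z -> absf f z = e%:E.
  by rewrite LE => /connected_component_sub[].
have LX : Lambda `<=` X by move=> z Lz; split; [exact/N0N/LN0|exact: Lf].
have [|C [c1 c2 c3 c4 c5]] :=
    component_clopen_nbhd cX (LX _ Lx0) (@thickening_open R Lambda s).
  move=> z Xz; apply: LN0; rewrite LE; case: Xz => D [Dx DX cD] Dz.
  exists D => //; split=> // w /DX[Nw fw]; split=> //.
  exact/standing_sub/NG.
have cC : compact C by exact: subclosed_compact cX c3.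
have LCC : Lambda `<=` C.
  have <- : Lambda `&` C = Lambda; last by move=> z [].
  have cLam : connected Lambda by rewrite LE; exact: component_connected.
  apply: cLam; [by exists x0| |by exists C].
  exists (~` (X `\` C)); first exact: closed_openC.
  apply/seteqP; split=> z [Lz Cz]; split=> //; first by case.
  by apply: contrapT => nCz; apply: Cz; split=> //; exact: LX.
(* Points closer than [rho] to [C] lie in [N0] and avoid the rest of [X], so a collar of [C] has no
   level point outside [C]. *)
have [||rho rho0 rhoP] :=
    @compact_closed_dist _ C ((X `\` C) `|` ~` N0) cC.
  by apply: closedU => //; exact/open_closedC/thickening_open.
  by rewrite -subset0 => z [Cz [[_ /(_ Cz)]|/(_ (c5 _ Cz))]].
have rho20 : 0 < rho / 2 by rewrite divr_gt0.
pose U := thickening C (rho / 2).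
have near_N0 z w : C w -> cmod (z - w) < rho -> N0 z /\ ~ (X `\` C) z.
  move=> Cw zw; split; [apply: contrapT|] => nz.
    by have := rhoP w z Cw (or_intror nz); rewrite cmodB; lra.
  by have := rhoP w z Cw (or_introl nz); rewrite cmodB; lra.
have clU z : closure U z -> N0 z /\ ~ (X `\` C) z.
  move=> /closure_thickening/(_ rho20)[w Cw zw]; apply: (near_N0 z w Cw).
  by rewrite mulrC divfK in zw.
exists U; split.
- exact: thickening_open.
- by move=> z /LCC; exact: sub_thickening.
- move=> z /subset_closure/clU[N0z _]; split; first exact/NG/N0N.
  by case: N0z => w Lw zw; exists w => //; lra.
- apply: (subclosed_compact _ cN) => [|z [/clU[/N0N]]//].
  rewrite setDE; apply: closedI; first exact: closed_closure.
  exact/open_closedC/thickening_open.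
- move=> z [/clU[N0z nXz] nUz]; split=> [|fz]; first exact/standing_sub/NG/N0N.
  apply: nXz; split.
    by split=> //; exact: N0N.
  by move=> Cz; apply: nUz; exact: sub_thickening Cz.
Qed.

(** Values are separated by disjoint open sets of [\bar R] rather than by a difference, because
    [absf f] may be [+oo] on [K]. *)
Lemma compact_level_gap (K : set R[i]) (e : R) : compact K -> K `<=` G' ->
  (forall z, K z -> absf f z <> e%:E) ->
  exists2 eta : R, 0 < eta & forall z, K z -> forall zeta : R,
    e - eta < zeta < e + eta -> absf f z <> zeta%:E.
Proof.
move=> cK KG' Ke; apply: (@compact_uniform _ K (fun eta z => forall zeta : R,
    e - eta < zeta < e + eta -> absf f z <> zeta%:E) cK) => x Kx.
have : hausdorff_space (\bar R) by exact: ereal_hausdorff.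
rewrite open_hausdorff => /(_ (absf f x) e%:E) [|[A B] /= [xA eB] [oA oB AB]].
  exact/eqP/Ke.
rewrite !inE in xA eB.
have nA : nbhs (absf f x) A by exact: open_nbhs_nbhs.
have /nbhs_EFin/nbhs_ballP[b /= b0 bB] : nbhs e%:E B by exact: open_nbhs_nbhs.
have /nbhs_cmodP[d d0 dA] := absf_continuous (sa_meromorphic hGf) (KG' _ Kx) nA.
exists (Num.min d b); first by rewrite lt_min d0.
move=> w eta; rewrite !lt_min => /andP[wd _] /andP[eta0 /andP[_ etab]].
move=> zeta /andP[z1 z2] fw.
have Aw : A zeta%:E by rewrite -fw; exact: dA.
have Bz : B zeta%:E.
  by apply: bB; rewrite /ball /= ltr_norml; apply/andP; split; lra.
by move/eqP: AB => AB; have : (A `&` B) zeta%:E by []; rewrite AB.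
Qed.

(** Since [L] misses the boundary of [U], its traces on [U] and on [closure U] agree, so this trace
    is clopen in [L]. *)
Lemma component_trapped U L A : open U -> connected L -> L `<=` A ->
  A `&` (closure U `\` U) = set0 -> (L `&` U) !=set0 -> L `<=` U.
Proof.
move=> oU cL LA AU LU; have <- : L `&` U = L; last by move=> z [].
apply: cL => //; first by exists U.
exists (closure U); first exact: closed_closure.
apply/seteqP; split=> z [Lz Uz]; split=> //; first exact: subset_closure.
apply: contrapT => nUz; have : (A `&` (closure U `\` U)) z.
  by split; [exact: LA|].
by rewrite AU.
Qed.

(** Half of [r] is spent on attaining [zeta] near [x], the other half on passing from [x] to nearby
    points of [Lambda], so that compactness yields one [eta]. *)
Lemma level_near_component (e : R) Lambda (r : R) : 0 < e ->
  is_component (level_set f G' e%:E) Lambda -> bounded_set Lambda ->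
  Lambda `<=` G -> 0 < r ->
  exists2 eta : R, 0 < eta & forall x, Lambda x -> forall zeta : R,
    e - eta < zeta < e + eta ->
    exists z, [/\ G z, cmod (z - x) < r & absf f z = zeta%:E].
Proof.
move=> e0 LC Lb LG r0; have cL := bounded_component_compact LC Lb LG.
apply: (@compact_uniform _ Lambda (fun eta x => forall zeta : R,
    e - eta < zeta < e + eta ->
    exists z, [/\ G z, cmod (z - x) < r & absf f z = zeta%:E]) cL) => x Lx.
have r20 : 0 < r / 2 by rewrite divr_gt0.
have fx : absf f x = e%:E.
  by case: LC Lx => x0 _ -> /connected_component_sub[].
have [eta eta0 etaP] := level_open standing_meromorphic (sa_open hGf) (LG _ Lx)
  e0 fx (bounded_component_not_near_cst LC Lb LG Lx) r20.
exists (Num.min eta (r / 2)); first by rewrite lt_min eta0.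
move=> w t; rewrite !lt_min => /andP[_ wx] /andP[t0 /andP[teta _]] zeta tz.
have [|z [Gz zx fz]] := etaP zeta.
  by case/andP: tz => z1 z2; apply/andP; split; lra.
exists z; split=> //; have := cmod_triangle z x w; rewrite (cmodB x w); lra.
Qed.

End StandingAssumptions.

(** * The two-sided distance and the choice of approximating level curves *)

Lemma dist_check_lt (R : realType) (X Y : set R[i]) (d e : R) : d < e ->
  X !=set0 -> Y !=set0 ->
  (forall x, X x -> exists2 y, Y y & cmod (x - y) <= d) ->
  (forall y, Y y -> exists2 x, X x & cmod (x - y) <= d) ->
  (dist_check X Y < e%:E)%E.
Proof.
move=> de X0 Y0 XY YX; rewrite /dist_check.
case: asboolP => [[X0'|Y0']|_].
- by move: X0; rewrite X0' => -[].
- by move: Y0; rewrite Y0' => -[].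
have dist_le (A B : set R[i]) x y : A x -> B y -> cmod (x - y) <= d ->
    (dist_set A B <= d%:E)%E.
  move=> Ax By xy; apply: (@le_trans _ _ (cmod (x - y))%:E).
    by apply: ereal_inf_lbound; exists x => //; exists y.
  by rewrite lee_fin.
rewrite gt_max; apply/andP; split; apply: (@le_lt_trans _ _ d%:E);
  rewrite ?lte_fin//; apply: ge_ereal_sup => _ [z Zz <-].
  by have [y Yy zy] := XY z Zz; exact: dist_le zy.
by have [x Xx xz] := YX z Zz; exact: dist_le xz.
Qed.

Theorem proposition3p7 (R : realType) (G G' : set R[i])
    (f : R[i] -> option R[i]) (hGf : standing_assumptions G G' f)
    (epsilon : R) (epsilon_gt0 : 0 < epsilon)
    (Lambda : set R[i])
    (Lambda_component : is_component (level_set f G' epsilon%:E) Lambda)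
    (Lambda_bounded : bounded_set Lambda) (Lambda_sub : Lambda `<=` G)
    (delta : R) (delta_gt0 : 0 < delta) :
  exists eta : R, 0 < eta < epsilon /\
    forall zeta : R, epsilon - eta < zeta < epsilon + eta ->
    exists (N : nat) (L : 'I_N -> set R[i]),
      (forall i, [/\ level_curve f G' (L i), L i `<=` G &
                     forall z, L i z -> absf f z = zeta%:E]) /\
      (dist_check (\bigcup_(i in [set: 'I_N]) L i) Lambda < delta%:E)%E.
Proof.
have d20 : 0 < delta / 2 by rewrite divr_gt0.
have d40 : 0 < delta / 4 by rewrite divr_gt0.
have cL := bounded_component_compact hGf Lambda_component Lambda_bounded
  Lambda_sub.
have [U [oU LU UG cS SP]] := isolating_neighbourhood hGf Lambda_component
  Lambda_bounded Lambda_sub d20.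
have [|rho rho0 rhoP] := compact_closed_dist cL (open_closedC oU).
  by rewrite -subset0 => z [/LU].
have [eta1 eta10 eta1P] := compact_level_gap hGf cS (fun z Sz => (SP z Sz).1)
  (fun z Sz => (SP z Sz).2).
have r0 : 0 < Num.min rho (delta / 4) by rewrite lt_min rho0.
have [eta2 eta20 eta2P] := level_near_component hGf epsilon_gt0
  Lambda_component Lambda_bounded Lambda_sub r0.
(* [eta1] keeps the level [zeta] off the boundary of [U], [eta2] makes it attained near [Lambda],
   and [epsilon / 2] ensures [eta < epsilon], hence [zeta > 0]. *)
pose eta := Num.min (Num.min eta1 eta2) (epsilon / 2).
have [e1 e2 e3] : [/\ eta <= eta1, eta <= eta2 & eta <= epsilon / 2].
  by rewrite /eta !ge_min !lexx !orbT.
exists eta; split.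
  by rewrite !lt_min eta10 eta20 divr_gt0//=; lra.
move=> zeta /andP[z1 z2].
have zeta1 : epsilon - eta1 < zeta < epsilon + eta1.
  by apply/andP; split; lra.
have zeta2 : epsilon - eta2 < zeta < epsilon + eta2.
  by apply/andP; split; lra.
have [s [sL sP]] := compact_net cL d40.
(* Closeness [rho] places [h x] inside [U]; closeness [delta / 4] adds to the mesh of the net to
   give [delta / 2]. Off [Lambda] the value 0 is a dummy. *)
have /choice[h hP] (x : R[i]) : exists z, Lambda x ->
    [/\ G z, cmod (z - x) < Num.min rho (delta / 4) & absf f z = zeta%:E].
  have [Lx|nLx] := pselect (Lambda x); last by exists 0.
  by have [z zP] := eta2P x Lx zeta zeta2; exists z.
have hU x : Lambda x -> U (h x).
  move=> Lx; have [_ + _] := hP x Lx; rewrite lt_min => /andP[hx _].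
  apply: contrapT => nU; have := rhoP x (h x) Lx nU; rewrite cmodB; lra.
pose E := level_set f G' zeta%:E.
have Eh x : Lambda x -> E (h x).
  by move=> /hP[Gh _ fh]; split=> //; exact: standing_sub hGf _ Gh.
(* Different net points may yield the same curve; repetitions do not affect the union. *)
pose L (i : 'I_(size s)) := connected_component E (h (nth 0 s i)).
have Ls (i : 'I_(size s)) : Lambda (nth 0 s i).
  by apply: sL; apply: mem_nth; exact: ltn_ord.
have Lh i : L i (h (nth 0 s i)) by apply: connected_component_refl; exact: Eh.
have LiU i : L i `<=` U.
  apply: (@component_trapped _ U (L i) E) => //.
  - exact: component_connected.
  - exact: connected_component_sub.
  - by rewrite -subset0 => z [[_ fz] Sz]; exact: eta1P Sz _ zeta1 fz.
  - by exists (h (nth 0 s i)); split=> //; exact: hU.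
exists (size s), L; split=> [i|].
  split.
  - exists zeta%:E; first by rewrite lee_fin; lra.
    by exists (h (nth 0 s i)) => //; exact: Eh.
  - by move=> z /LiU/UG[].
  - by move=> z /connected_component_sub[].
have [x0 Ex0 LE] := Lambda_component.
have Lx0 : Lambda x0 by rewrite LE; exact: connected_component_refl.
have cover y : Lambda y ->
    exists2 z, (\bigcup_(i in [set: 'I_(size s)]) L i) z &
      cmod (z - y) <= delta / 2.
  move=> Ly; have [x xs yx] := sP y Ly.
  have xi : (index x s < size s)%N by rewrite index_mem.
  exists (h x).
    by exists (Ordinal xi) => //; have := Lh (Ordinal xi); rewrite /= nth_index.
  have [_ + _] := hP x (sL _ xs); rewrite lt_min => /andP[_ hx].
  have := cmod_triangle (h x) x y; rewrite (cmodB x y); lra.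
(* A bound strictly below [delta] is needed, since a supremum of distances smaller than [delta]
   could equal [delta]. *)
apply: (@dist_check_lt _ _ _ (delta / 2)); first by lra.
- by have [z zL _] := cover _ Lx0; exists z.
- by exists x0.
- by move=> z [i _ /LiU/UG[_ [y Ly zy]]]; exists y => //; exact: ltW.
- exact: cover.
Qed.
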